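(* Let $\mathfrak{F}^\perp$ be the canonical totally real foliation on a quaternion CR-submanifold $M$ of a quaternion Kähler manifold $(\overline{M},\sigma,\overline{g})$. The following assertions are equivalent: (i) $\mathfrak{F}^\perp$ is totally geodesic; (ii) $B(X,Y)\in\Gamma(\mu)$ for all $X\in\Gamma(D)$, $Y\in\Gamma(D^\perp)$; (iii) $A_NX\in\Gamma(D^\perp)$ for all $X\in\Gamma(D^\perp)$, $N\in\Gamma(\mu^\perp)$; (iv) $A_NY\in\Gamma(D)$ for all $Y\in\Gamma(D)$, $N\in\Gamma(\mu^\perp)$.
   Context: Quaternion Kähler manifold: a Riemannian manifold $(\overline{M},\overline{g})$ with a rank 3 subbundle $\sigma$ of $End(T\overline{M})$ which locally admits bases of sections $\{J_1,J_2,J_3\}$ (called canonical local bases) with $J_1^2=J_2^2=J_3^2=-Id$, $J_1J_2=-J_2J_1=J_3$, such that $\overline{g}(J_\alpha X,J_\alpha Y)=\overline{g}(X,Y)$ for $\alpha\in\{1,2,3\}$ and all vector fields $X,Y$, and such that $\sigma$ is parallel with respect to the Levi-Civita connection $\overline{\nabla}$ of $\overline{g}$. Quaternion CR-submanifold: a submanifold $M$ of $\overline{M}$, with induced metric $g$ and Levi-Civita connection $\nabla$, admitting two orthogonal complementary distributions $D$ and $D^\perp$ (so $TM=D\oplus D^\perp$) such that, for every $x\in M$, every canonical local basis and every $\alpha\in\{1,2,3\}$, $J_\alpha(D_x)\subseteq D_x$ and $J_\alpha(D^\perp_x)\subseteq T_xM^\perp$ (the normal space). $D$ is called the quaternion distribution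 and $D^\perp$ the totally real distribution. $B$ denotes the second fundamental form of $M$ in $\overline{M}$: $\overline{\nabla}_XY=\nabla_XY+B(X,Y)$ for $X,Y\in\Gamma(TM)$. For a normal field $N\in\Gamma(TM^\perp)$, the shape operator $A_N$ and normal connection $\nabla^\perp$ are given by $\overline{\nabla}_XN=-A_NX+\nabla^\perp_XN$, so $g(A_NX,Y)=\overline{g}(B(X,Y),N)$. The normal bundle decomposes orthogonally as $TM^\perp=\mu\oplus\mu^\perp$, where $\mu^\perp=J_1D^\perp\oplus J_2D^\perp\oplus J_3D^\perp$ and $\mu$ is the orthogonal complement of $\mu^\perp$ in $TM^\perp$. It is known that $D^\perp$ is always integrable; the foliation $\mathfrak{F}^\perp$ of $M$ with tangent distribution $D^\perp$ (and transversal distribution $D$) is called the canonical totally real foliation. It is totally geodesic if its leaves are totally geodesic submanifolds of $(M,g)$, i.e. $\nabla_XZ\in\Gamma(D^\perp)$ for all $X,Z\in\Gamma(D^\perp)$. *)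

(* Defs.v *)
From mathcomp Require Import all_boot all_order all_algebra.
From mathcomp Require Import all_classical all_reals all_analysis.
From mathcomp Require Import ring.

Set Implicit Arguments.
Unset Strict Implicit.
Unset Printing Implicit Defensive.

Import Order.TTheory GRing.Theory Num.Theory.
Import numFieldNormedType.Exports.

Local Open Scope classical_set_scope.
Local Open Scope ring_scope.

Fixpoint Ck_on (R : realType) (V W : normedModType R) (k : nat) (U : set V)
    (h : V -> W) : Prop :=
  if k is k'.+1 then
    (forall y, U y -> differentiable h y) /\
    (forall v : V, Ck_on k' U ('D_v h))
  else forall y, U y -> {for y, continuous h}.

Definition smooth_on (R : realType) (V W : normedModType R) (U : set V)
  (h : V -> W) : Prop := forall k, Ck_on k U h.

Record chart (R : realType) (n : nat) (T : topologicalType) := Chart {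
  cdom : set T;
  cmap :> T -> 'rV[R]_n;
  cinv : 'rV[R]_n -> T;
  cdom_open : open cdom;
  cimg_open : open (cmap @` cdom);
  cmapK : forall x, cdom x -> cinv (cmap x) = x;
  cmap_cts : forall x, cdom x -> {for x, continuous cmap};
  cinv_cts : forall y, (cmap @` cdom) y -> {for y, continuous cinv} }.

(* The atlas is indexed by the points, the chart of index p being a chart
   around p.  Every smooth structure has such an atlas (choose one chart around
   each point), and it determines the structure. *)
Record manifold (R : realType) (n : nat) := Manifold {
  carrier :> topologicalType;
  phi : carrier -> chart R n carrier;
  phi_dom : forall p, cdom (phi p) p;
  phi_smooth : forall q r,
    smooth_on (phi q @` (cdom (phi q) `&` cdom (phi r)))
              (phi r \o cinv (phi q));
  manifold_hausdorff : hausdorff_space carrier;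
  manifold_countable : @second_countable carrier }.

(* A tangent vector at p is represented by its components in the chart phi p,
   so the tangent space at p is 'rV[R]_n.  Linear maps act on the right:
   the image of v by the map of matrix A is v *m A, and the matrix of A \o B is
   B *m A. *)

Section Manifolds.
Variable R : realType.

Section OneManifold.
Variables (n : nat) (M : manifold R n).

(* matrix of the identity of T_p M from the components in the chart phi q to
   those in the chart phi r *)
Definition chg (q r p : M) : 'M[R]_n :=
  'J (phi r \o cinv (phi q)) (phi q p).

(* components in the chart phi r, at p, of an endomorphism of T_p M and of a
   bilinear form on T_p M *)
Definition end_coord (r : M) (A : M -> 'M[R]_n) (p : M) : 'M[R]_n :=
  chg r p p *m A p *m chg p r p.

Definition form_coord (r : M) (g : M -> 'M[R]_n) (p : M) : 'M[R]_n :=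
  chg r p p *m g p *m (chg r p p)^T.

Definition smooth_end (O : set M) (A : M -> 'M[R]_n) : Prop :=
  forall r, smooth_on (phi r @` (cdom (phi r) `&` O))
                      (end_coord r A \o cinv (phi r)).

Definition ip (g : M -> 'M[R]_n) (p : M) (u v : 'rV[R]_n) : R :=
  (u *m g p *m v^T) 0 0.

Record riemannian (g : M -> 'M[R]_n) : Prop := Riemannian {
  metric_sym : forall p, (g p)^T = g p;
  metric_pos : forall p u, u != 0 -> 0 < ip g p u u;
  metric_smooth : forall r, smooth_on (phi r @` cdom (phi r))
                                      (form_coord r g \o cinv (phi r)) }.

(* The Levi-Civita connection is given by its Christoffel symbols; at p they are
   only needed in the chart phi p.  [dmetric g p i j l] is d_i g_jl and
   [christoffel g p i j k] is Gamma^k_ij. *)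
Definition dmetric (g : M -> 'M[R]_n) (p : M) (i j l : 'I_n) : R :=
  'D_(delta_mx 0 i) (fun y => form_coord p g (cinv (phi p) y) j l : R^o)
    (phi p p).

Definition christoffel (g : M -> 'M[R]_n) (p : M) (i j k : 'I_n) : R :=
  2^-1 * \sum_l (dmetric g p i j l + dmetric g p j i l - dmetric g p l i j)
                * invmx (g p) l k.

(* the connection form: w *m conn g p v has components
   \sum_(i, j) v^i w^j Gamma^k_ij *)
Definition conn (g : M -> 'M[R]_n) (p : M) (v : 'rV[R]_n) : 'M[R]_n :=
  \matrix_(j, k) \sum_i v 0 i * christoffel g p i j k.

(* [conn] is torsion-free and metric, which characterizes Levi-Civita. *)
Lemma conn_torsion_free (g : M -> 'M[R]_n) (p : M) (v w : 'rV[R]_n) :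
  riemannian g -> w *m conn g p v = v *m conn g p w.
Proof.
move=> hg; have dmC i j l : dmetric g p i j l = dmetric g p i l j.
  congr ('D_(delta_mx 0 i) _ (phi p p)); apply/funext => y.
  by rewrite -[in LHS](trmxK (form_coord _ _ _)) mxE /form_coord !trmx_mul
             trmxK (metric_sym hg) mulmxA.
have chC i j k : christoffel g p i j k = christoffel g p j i k.
  rewrite /christoffel; congr (_ * _); apply: eq_bigr => l _; congr (_ * _).
  by rewrite [dmetric g p l i j]dmC [X in X - _]addrC.
apply/rowP => k; rewrite !mxE.
under eq_bigr do rewrite mxE mulr_sumr.
under [RHS]eq_bigr do rewrite mxE mulr_sumr.
rewrite exchange_big /=; apply: eq_bigr => i _; apply: eq_bigr => j _.
by rewrite chC mulrCA.
Qed.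

Lemma conn_metric (g : M -> 'M[R]_n) (p : M) (i j l : 'I_n) :
  riemannian g ->
  dmetric g p i j l = (conn g p (delta_mx 0 i) *m g p) j l
                      + (conn g p (delta_mx 0 i) *m g p) l j.
Proof.
move=> hg; have dmC a b c : dmetric g p a b c = dmetric g p a c b.
  congr ('D_(delta_mx 0 a) _ (phi p p)); apply/funext => y.
  by rewrite -[in LHS](trmxK (form_coord _ _ _)) mxE /form_coord !trmx_mul
             trmxK (metric_sym hg) mulmxA.
have gU : g p \in unitmx.
  rewrite -row_free_unit -kermx_eq0; apply/negPn/negP => /rowV0Pn[u].
  move=> /sub_kermxP ug u0; have := metric_pos hg p u0.
  by rewrite /ip ug mul0mx mxE ltxx.
pose S a b : 'rV[R]_n :=
  \row_c (dmetric g p a b c + dmetric g p b a c - dmetric g p c a b).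
have E a b : (conn g p (delta_mx 0 a) *m g p) b =
             (2^-1 *: S a b *m invmx (g p) *m g p) 0.
  apply/funext => c; rewrite !mxE; apply: eq_bigr => k _; congr (_ * _).
  rewrite !mxE (bigD1 a) //= big1 ?addr0 => [|d /negPf da]; last first.
    by rewrite mxE da andbF mul0r.
  rewrite mxE !eqxx mul1r /christoffel mulr_sumr; apply: eq_bigr => d _.
  by rewrite !mxE mulrA.
rewrite !E !mulmxKV // !mxE -mulrDr (dmC i l j) (dmC j i l) (dmC l i j).
by field.
Qed.

(* covariant derivative at p, in the direction v, of a field A of
   endomorphisms: (nabla_v A) Y = nabla_v (A Y) - A (nabla_v Y) *)
Definition cov_end (g : M -> 'M[R]_n) (v : 'rV[R]_n) (A : M -> 'M[R]_n)
    (p : M) : 'M[R]_n :=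
  'D_v (end_coord p A \o cinv (phi p)) (phi p p)
    + A p *m conn g p v - conn g p v *m A p.

End OneManifold.

Section Maps.
Variables (m n : nat) (M : manifold R m) (P : manifold R n) (f : M -> P).

Definition smooth_map : Prop :=
  continuous f /\
  forall q r, smooth_on (phi q @` (cdom (phi q) `&` f @^-1` cdom (phi r)))
                        (phi r \o f \o cinv (phi q)).

Definition dmap (x : M) : 'M[R]_(m, n) :=
  'J (phi (f x) \o f \o cinv (phi x)) (phi x x).

(* injective immersions: both embedded and immersed submanifolds *)
Definition submanifold : Prop :=
  [/\ smooth_map, injective f & forall x, row_free (dmap x)].

(* In the rest of the section N x is a vector of T_(f x) P. *)
Definition coord_along (r : P) (N : M -> 'rV[R]_n) (x : M) : 'rV[R]_n :=
  N x *m chg (f x) r (f x).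

Definition smooth_along (O : set M) (N : M -> 'rV[R]_n) : Prop :=
  forall q r,
    smooth_on (phi q @` (cdom (phi q) `&` O `&` f @^-1` cdom (phi r)))
              (coord_along r N \o cinv (phi q)).

Definition sections_along (E : M -> set 'rV[R]_n) : set (M -> 'rV[R]_n) :=
  [set N | smooth_along setT N /\ forall x, E x (N x)].

Definition cov_along (g : P -> 'M[R]_n) (X : M -> 'rV[R]_m)
    (N : M -> 'rV[R]_n) (x : M) : 'rV[R]_n :=
  'D_(X x) (coord_along (f x) N \o cinv (phi x)) (phi x x)
    + N x *m conn g (f x) (X x *m dmap x).

Definition induced_metric (g : P -> 'M[R]_n) (x : M) : 'M[R]_m :=
  dmap x *m g (f x) *m (dmap x)^T.

Definition normal (g : P -> 'M[R]_n) (x : M) : set 'rV[R]_n :=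
  [set w | forall u : 'rV[R]_m, ip g (f x) w (u *m dmap x) = 0].

(* the u in T_x M such that w - u *m dmap x is normal *)
Definition tangent_part (g : P -> 'M[R]_n) (x : M) (w : 'rV[R]_n) :
    'rV[R]_m :=
  w *m g (f x) *m (dmap x)^T *m invmx (induced_metric g x).

End Maps.

Definition sections (m : nat) (M : manifold R m) (E : M -> {vspace 'rV[R]_m}) :
    set (M -> 'rV[R]_m) :=
  sections_along (@idfun M) (fun x => [set u | u \in E x]).

Definition nabla (m : nat) (M : manifold R m) (g : M -> 'M[R]_m)
    (X Y : M -> 'rV[R]_m) : M -> 'rV[R]_m :=
  cov_along (@idfun M) g X Y.

Definition distribution (m : nat) (M : manifold R m)
    (E : M -> {vspace 'rV[R]_m}) : Prop :=
  exists k : nat, forall x0 : M, exists (O : set M) (e : 'I_k -> M -> 'rV[R]_m),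
    [/\ open O, O x0, forall i, smooth_along (@idfun M) O (e i) &
        forall x, O x -> basis_of (E x) [tuple e i x | i < k]].

Section Submanifold.
Variables (m n : nat) (M : manifold R m) (P : manifold R n) (f : M -> P).
Variable g : P -> 'M[R]_n.

Lemma tangent_partP (x : M) (w : 'rV[R]_n) :
  riemannian g -> row_free (dmap f x) ->
  normal f g x (w - tangent_part f g x w *m dmap f x).
Proof.
move=> hg Ff u; have IU : induced_metric f g x \in unitmx.
  rewrite -row_free_unit -kermx_eq0; apply/negPn/negP => /rowV0Pn[v].
  move=> /sub_kermxP vg v0.
  have v1 : v *m dmap f x != 0 by rewrite mulmx_free_eq0.
  have := metric_pos hg (f x) v1.
  rewrite /ip trmx_mul !mulmxA -(mulmxA v) -(mulmxA v).
  by rewrite -/(induced_metric f g x) vg mul0mx mxE ltxx.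
rewrite /ip trmx_mul mulmxA !mulmxBl.
have -> : tangent_part f g x w *m dmap f x *m g (f x) *m (dmap f x)^T =
          tangent_part f g x w *m induced_metric f g x.
  by rewrite /induced_metric !mulmxA.
by rewrite /tangent_part mulmxKV // subrr mxE.
Qed.

Definition push (Y : M -> 'rV[R]_m) (x : M) : 'rV[R]_n := Y x *m dmap f x.

Definition second_form (X Y : M -> 'rV[R]_m) (x : M) : 'rV[R]_n :=
  cov_along f g X (push Y) x - push (nabla (induced_metric f g) X Y) x.

Definition shape_op (N : M -> 'rV[R]_n) (X : M -> 'rV[R]_m) (x : M) : 'rV[R]_m :=
  - tangent_part f g x (cov_along f g X N x).

End Submanifold.

Section Quaternionic.
Variables (n : nat) (P : manifold R n).
Variables (g : P -> 'M[R]_n) (sigma : P -> {vspace 'M[R]_n}).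

(* J_1, J_2, J_3 are J 0, J 1, J 2; recall that J_1 \o J_2 has matrix
   J 1 *m J 0. *)
Definition canonical_basis (O : set P) (J : 'I_3 -> P -> 'M[R]_n) : Prop :=
  [/\ open O,
      forall a, smooth_end O (J a),
      forall p, O p -> basis_of (sigma p) [tuple J a p | a < 3],
      forall p, O p -> forall a, J a p *m J a p = - 1%:M &
      forall p, O p -> J 1 p *m J 0 p = J 2 p /\ J 0 p *m J 1 p = - J 2 p].

Definition parallel : Prop :=
  forall (O : set P) (A : P -> 'M[R]_n),
    open O -> smooth_end O A -> (forall p, O p -> A p \in sigma p) ->
    forall p, O p -> forall v, cov_end g v A p \in sigma p.

Record quaternion_kahler : Prop := QuaternionKahler {
  qk_metric : riemannian g;
  qk_basis : forall p, exists O J, canonical_basis O J /\ O p;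
  qk_hermitian : forall O J, canonical_basis O J -> forall p, O p ->
    forall a u v, ip g p (u *m J a p) (v *m J a p) = ip g p u v;
  qk_parallel : parallel }.

Variables (m : nat) (M : manifold R m) (f : M -> P).
Variables D Dperp : M -> {vspace 'rV[R]_m}.

Record quaternion_CR_submanifold : Prop := QuaternionCR {
  qcr_sub : submanifold f;
  qcr_D : distribution D;
  qcr_Dperp : distribution Dperp;
  qcr_compl : forall x, (D x + Dperp x)%VS = fullv;
  qcr_orth : forall x u v, u \in D x -> v \in Dperp x ->
    ip (induced_metric f g) x u v = 0;
  qcr_inv : forall x O J, canonical_basis O J -> O (f x) -> forall a u,
    u \in D x -> exists2 u', u' \in D x &
                             u *m dmap f x *m J a (f x) = u' *m dmap f x;
  qcr_real : forall x O J, canonical_basis O J -> O (f x) -> forall a u,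
    u \in Dperp x -> normal f g x (u *m dmap f x *m J a (f x)) }.

(* J_1 Dperp + J_2 Dperp + J_3 Dperp; the sum is orthogonal and does not depend
   on the canonical basis *)
Definition mu_perp (x : M) : set 'rV[R]_n :=
  [set w | exists O J (z : 'I_3 -> 'rV[R]_m),
    [/\ canonical_basis O J, O (f x), forall a, z a \in Dperp x &
        w = \sum_a z a *m dmap f x *m J a (f x)]].

Definition mu (x : M) : set 'rV[R]_n :=
  [set w | normal f g x w /\ forall w', mu_perp x w' -> ip g (f x) w w' = 0].

(* totally geodesic leaves of the foliation tangent to Dperp *)
Definition foliation_totally_geodesic : Prop :=
  forall X Z, sections Dperp X -> sections Dperp Z ->
    sections Dperp (nabla (induced_metric f g) X Z).

End Quaternionic.

End Manifolds.

(* Main.v *)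
Require Import Defs.
From mathcomp Require Import all_boot all_order all_algebra.
From mathcomp Require Import all_classical all_reals all_analysis.
From mathcomp Require Import ring lra.

(* Fix a point x, u and z in Dperp_x, v in D_x, a canonical basis J_1, J_2, J_3
   at f x, and let B be the second fundamental form.  For X, Z in Dperp and Y in
   D, since nabla J_a is a combination of the J_b and the J_b Z are normal,
     g (nabla_X Z) Y = gbar (nablabar_X (J_a Z)) (J_a Y)
                     = - gbar (J_a Z) (B (X, J_a Y)),
   so that (i) says that B (u, v) is orthogonal to every J_a z; so do (ii), and
   (iii) and (iv) through gbar (B (u, v)) N = g (A_N u) v = g (A_N v) u.  Since B is
   tensorial, passing from fields to vectors only requires extending a vector of
   a distribution to a global section, with a bump function.  The analytic
   content is the transformation law of the Christoffel symbols of the first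
   kind under pullback by a map F,
     [u, v; w]_(F^* G) = [F' u, F' v; F' w]_G + G (D_u D_v F, F' w),
   which gives both the independence of the covariant derivative from the chart
   (F a change of charts), hence its smoothness, and the Gauss formula (F = f in
   charts). *)

Set Implicit Arguments.
Unset Strict Implicit.
Unset Printing Implicit Defensive.

Import Order.TTheory GRing.Theory Num.Theory.
Import numFieldNormedType.Exports.

Local Open Scope classical_set_scope.
Local Open Scope ring_scope.

(** * Smooth functions on open sets *)

(** A tangent vector at p is recorded in the chart [phi p], and p -> [phi p] is an arbitrary choice,
    so even a smooth field may have components that jump from point to point. What [conn] or
    [cov_along] computes at p is thus legible at p only; to differentiate it or to prove it smooth,
    it must first be rewritten in charts that stay fixed near p, and then the second derivatives of
    the change of charts appear. This is why the transformation law is needed. Smoothness is part of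
    the claim: each of (i) to (iv) asserts that some field is a smooth global section, so nabla, B
    and A_N must be shown to preserve smoothness. Conversely, (iii) and (iv) can be tested only on
    global normal fields, while a canonical basis is local; the field J_a Z that extends J_a z is
    cut off as well, and stays in [mu_perp] because [mu_perp] contains 0 and is stable under
    scaling. *)

Lemma near_eq_differentiable (R : realType) (V W : normedModType R)
    (h h' : V -> W) (y : V) :
  (\near y, h y = h' y) -> differentiable h y -> differentiable h' y.
Proof.
move=> hh' dh.
have hh0 : \forall z \near 0, h (z + y) = h' (z + y).
  by have := hh'; rewrite (near_shift 0 y) /= subr0.
(* The first-order expansion sees only the germ of the function, so the differential of [h] serves
   for [h']; [diff_unique] then identifies the two. *)
have E : h' \o shift y = cst (h' y) + 'd h y +o_ 0 id.
  apply/eqaddoP => _/posnumP[e].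
  have /eqaddoP/(_ e%:num [gt0 of e%:num]) H := diff_locally dh.
  apply: filterS2 H hh0 => z; rewrite -![(_ + _ : _ -> _) _]/(_ + _) /=.
  by rewrite /cst (nbhs_singleton hh') => H hz; rewrite /= -hz.
have cd : continuous ('d h y) by exact: diff_continuous.
by apply/diff_locallyP; rewrite (diff_unique cd E).
Qed.

Section SmoothCalculus.
Variable R : realType.

Section Basics.
Variables V W : normedModType R.
Implicit Types (U : set V) (h : V -> W).

Lemma open_near U y : open U -> U y -> \near y, U y.
Proof. by move=> oU Uy; apply: open_nbhs_nbhs. Qed.

Lemma eq_on_near U h h' y : open U -> U y -> (forall y, U y -> h y = h' y) ->
  \near y, h y = h' y.
Proof. by move=> oU Uy hh'; apply: filterS (open_near oU Uy). Qed.

(** Functions are total and may differ off U; since U is open, their directional derivatives still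
    agree on U, which feeds the induction. *)
Lemma Ck_on_eq k U h h' : open U -> (forall y, U y -> h y = h' y) ->
  Ck_on k U h -> Ck_on k U h'.
Proof.
move=> oU; elim: k h h' => [|k IH] h h' hh' /=.
  move=> ch y Uy; rewrite /prop_for /continuous_at -(hh' y Uy).
  apply: cvg_trans (ch y Uy); apply: near_eq_cvg.
  exact: eq_on_near oU Uy hh'.
move=> [dh Dh]; split=> [y Uy|v].
  apply: near_eq_differentiable (dh y Uy); exact: eq_on_near oU Uy hh'.
apply: IH (Dh v) => y Uy; apply: near_eq_derive; exact: eq_on_near oU Uy hh'.
Qed.

(** [Ck_on] is a condition at each point of U on derivatives taken in all of V, so a set U' around y
    only has to contain y. *)
Lemma Ck_on_local k U h :
  (forall y, U y -> exists2 U', U' y & Ck_on k U' h) -> Ck_on k U h.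
Proof.
elim: k h => [|k IH] h H /=; first by move=> y /H[U' U'y /(_ y U'y)].
split=> [y /H[U' U'y [+ _]]|v]; first by apply.
by apply: IH => y /H[U' U'y [_ /(_ v)]]; exists U'.
Qed.

Lemma smooth_on_eq U h h' : open U -> (forall y, U y -> h y = h' y) ->
  smooth_on U h -> smooth_on U h'.
Proof. by move=> oU hh' sh k; apply: Ck_on_eq (sh k). Qed.

Lemma smooth_on_local U h :
  (forall y, U y -> exists2 U', U' y & smooth_on U' h) -> smooth_on U h.
Proof.
by move=> H k; apply: Ck_on_local => y /H[U' U'y /(_ k)]; exists U'.
Qed.

Lemma smooth_on_sub U U' h : U' `<=` U -> smooth_on U h -> smooth_on U' h.
Proof.
by move=> UU' sh; apply: smooth_on_local => y /UU'; exists U.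
Qed.

Lemma smooth_on_diff U h y : smooth_on U h -> U y -> differentiable h y.
Proof. by move=> /(_ 1%N)[+ _]; apply. Qed.

Lemma smooth_on_derive U h v : smooth_on U h -> smooth_on U ('D_v h).
Proof. by move=> sh k; have [_ Dh] := sh k.+1; exact: Dh. Qed.

Lemma smooth_on_derivable U h v y : smooth_on U h -> U y -> derivable h y v.
Proof. by move=> sh Uy; apply/diff_derivable/(smooth_on_diff sh). Qed.

Lemma Ck_on0 k U : Ck_on k U (cst 0 : V -> W).
Proof.
elim: k => [|k IH] /=; first by move=> y _; exact: cvg_cst.
split=> [y _|v]; first exact: differentiable_cst.
by rewrite (_ : 'D_v _ = cst 0)//; apply/funext => y; rewrite derive_cst.
Qed.

Lemma Ck_onD k U h h' : open U -> Ck_on k U h -> Ck_on k U h' ->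
  Ck_on k U (fun y => h y + h' y).
Proof.
move=> oU; elim: k h h' => [|k IH] h h' /=.
  by move=> ch ch' y Uy; apply: cvgD; [exact: ch|exact: ch'].
move=> [dh Dh] [dh' Dh']; split=> [y Uy|v].
  by apply: differentiableD; [exact: dh|exact: dh'].
apply: Ck_on_eq (IH _ _ (Dh v) (Dh' v)) => // y Uy; rewrite [RHS]deriveD //.
  exact/diff_derivable/dh.
exact/diff_derivable/dh'.
Qed.

Lemma Ck_on_sum k U n (h : 'I_n -> V -> W) : open U ->
  (forall i, Ck_on k U (h i)) -> Ck_on k U (fun y => \sum_i h i y).
Proof.
move=> oU; elim: n h => [|n IH] h ch.
  by apply: Ck_on_eq (@Ck_on0 k U) => // y _; rewrite big_ord0.
apply: Ck_on_eq (Ck_onD oU (IH (fun i => h (widen_ord (leqnSn n) i)) _) (ch ord_max)) => //.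
by move=> y _; rewrite big_ord_recr.
Qed.

(* A class of functions is smooth as soon as it is, up to finite sums, stable under
   directional derivatives: this one induction replaces those of all closure
   lemmas. *)
Lemma smooth_on_gen U (B : (V -> W) -> Prop) : open U ->
  (forall h, B h -> (forall y, U y -> differentiable h y) /\
    forall v, exists n (b : 'I_n -> V -> W), (forall i, B (b i)) /\
      forall y, U y -> 'D_v h y = \sum_i b i y) ->
  forall h, B h -> smooth_on U h.
Proof.
move=> oU HB h Bh k; elim: k h Bh => [|k IH] h /HB[dh Dh] /=.
  by move=> y /dh; exact: differentiable_continuous.
split=> // v; have [n [b [Bb E]]] := Dh v.
have H i : Ck_on k U (b i) by exact/IH/Bb.
by apply: Ck_on_eq (Ck_on_sum oU H) => // y Uy; rewrite E.
Qed.

Lemma smooth_onP U h : (forall y, U y -> differentiable h y) ->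
  (forall v, smooth_on U ('D_v h)) -> smooth_on U h.
Proof.
move=> dh Dh [|k]; last by split=> // v; exact: Dh.
by move=> y /dh; exact: differentiable_continuous.
Qed.

Lemma smooth_on_cst U (c : W) : smooth_on U (cst c).
Proof.
apply: smooth_onP => [y _|v k]; first exact: differentiable_cst.
rewrite (_ : 'D_v _ = cst 0); first exact: Ck_on0.
by apply/funext => y; rewrite derive_cst.
Qed.

Lemma smooth_onD U h h' : open U -> smooth_on U h -> smooth_on U h' ->
  smooth_on U (fun y => h y + h' y).
Proof. by move=> oU sh sh' k; apply: Ck_onD. Qed.

Lemma smooth_on_sum U n (h : 'I_n -> V -> W) : open U ->
  (forall i, smooth_on U (h i)) -> smooth_on U (fun y => \sum_i h i y).
Proof. by move=> oU sh k; apply: Ck_on_sum => // i; exact: sh. Qed.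

End Basics.
Section Scalar.
Variable V : normedModType R.
Variable U : set V.
Hypothesis oU : open U.

Lemma smooth_onM (a b : V -> R) : smooth_on U a -> smooth_on U b ->
  smooth_on U (fun y => a y * b y).
Proof.
move=> sa sb; pose B (h : V -> R) := exists a b : V -> R,
  [/\ smooth_on U a, smooth_on U b & h = (fun y => a y * b y)].
apply: (@smooth_on_gen _ _ U B); [exact: oU| |by exists a, b].
move=> _ [{sa}a [{sb}b [sa sb ->]]]; split=> [y Uy|v].
  by apply: differentiableM; [apply: smooth_on_diff sa _|apply: smooth_on_diff sb _].
exists 2, (fun i y => if i == 0 then 'D_v a y * b y else a y * 'D_v b y).
split=> [i|y Uy]; last first.
  rewrite !big_ord_recl big_ord0 /= addr0 [LHS]deriveM; last 2 first.
  - exact: smooth_on_derivable sa Uy.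
  - exact: smooth_on_derivable sb Uy.
  by rewrite addrC; congr (_ + _); rewrite mulrC.
case: (i == 0); [exists ('D_v a), b|exists a, ('D_v b)];
  by split=> //; apply: smooth_on_derive.
Qed.

(** The family a / h^(n+1), with a smooth, is stable under derivatives: the new numerator is h Da -
    (n+1) a Dh, over h^(n+2). *)
Lemma smooth_onV (h : V -> R) : smooth_on U h -> (forall y, U y -> h y != 0) ->
  smooth_on U (fun y => (h y)^-1).
Proof.
move=> sh h0; pose B (k : V -> R) := exists (a : V -> R) n,
  smooth_on U a /\ k = (fun y => a y * (h y)^-1 ^+ n.+1).
apply: (@smooth_on_gen _ _ U B); [exact: oU| |exists (cst 1), 0%N]; last first.
  split; [exact: smooth_on_cst|].
  by apply/funext => y; rewrite mul1r expr1.
have dV y n : U y -> differentiable (fun y => (h y)^-1 ^+ n.+1) y.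
  move=> Uy; rewrite -(exprfctE (fun y => (h y)^-1)); apply: differentiableX.
  by apply: differentiableV; [exact: smooth_on_diff sh Uy|exact: h0].
move=> _ [a [n [sa ->]]]; split=> [y Uy|v].
  by apply: differentiableM; [exact: smooth_on_diff sa Uy|exact: dV].
exists 1%N, (fun _ y => ('D_v a y * h y - n.+1%:R * a y * 'D_v h y) * (h y)^-1 ^+ n.+2).
split=> [i|y Uy].
  eexists; exists n.+1; split; last by apply/funext => y.
  have -> : (fun y => 'D_v a y * h y - n.+1%:R * a y * 'D_v h y) =
    (fun y => 'D_v a y * h y + (- n.+1%:R * a y) * 'D_v h y).
    by apply/funext => y; rewrite !mulNr.
  apply: smooth_onD => //; apply: smooth_onM => //; try exact: smooth_on_derive.
  by apply: smooth_onM => //; exact: smooth_on_cst.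
have da := @smooth_on_derivable _ _ _ _ v _ sa Uy.
have dh := @smooth_on_derivable _ _ _ _ v _ sh Uy.
have hy := h0 _ Uy.
rewrite big_ord_recl big_ord0 addr0 [LHS]deriveM; [|exact: da|exact/diff_derivable/dV].
have -> : 'D_v (fun y => (h y)^-1 ^+ n.+1) y =
   n.+1%:R * (h y)^-1 ^+ n * (- (h y) ^- 2 * 'D_v h y).
  rewrite -(exprfctE (fun y => (h y)^-1)) deriveX; last exact: derivableV.
  by rewrite deriveV.
rewrite /GRing.scale /= !exprS; move: ((h y)^-1 ^+ n) => w; by field.
Qed.

End Scalar.

(** * Matrix-valued functions *)

Section Matrices.
Variable V : normedModType R.

Lemma differentiable_mxP a b (h : V -> 'M[R]_(a, b)) y :
  differentiable h y <-> forall i j, differentiable (fun y => h y i j) y.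
Proof.
split=> [dh i j|dh].
  by apply: (@differentiable_comp _ _ _ _ h (fun A : 'M[R]_(a, b) => A i j)) => //;
     exact: differentiable_coord.
have -> : h = \sum_i \sum_j (fun y => h y i j *: delta_mx i j).
  apply/funext => z; rewrite [LHS]matrix_sum_delta fct_sumE.
  by apply: eq_bigr => i _; rewrite fct_sumE.
apply: differentiable_sum => i; apply: differentiable_sum => j.
exact: differentiableZl.
Qed.

Lemma derive_entry a b (h : V -> 'M[R]_(a, b)) y v i j : derivable h y v ->
  ('D_v h y) i j = 'D_v (fun y => h y i j) y.
Proof. by move=> /derive_mx ->; rewrite mxE. Qed.

Lemma differentiable_trmx a b (h : V -> 'M[R]_(a, b)) y :
  differentiable h y -> differentiable (fun y => (h y)^T) y.
Proof.
move=> /differentiable_mxP dh; apply/differentiable_mxP => i j.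
by under eq_fun do rewrite mxE.
Qed.

Lemma derive_trmx a b (h : V -> 'M[R]_(a, b)) y v : differentiable h y ->
  'D_v (fun y => (h y)^T) y = ('D_v h y)^T.
Proof.
move=> dh; apply/matrixP => i j; rewrite mxE !derive_entry; last 2 first.
- exact: diff_derivable.
- exact/diff_derivable/differentiable_trmx.
by under eq_fun do rewrite mxE.
Qed.

Section Product.
Variables (a b c : nat) (h : V -> 'M[R]_(a, b)) (k : V -> 'M[R]_(b, c)).

Lemma mulmx_entryE i j :
  (fun y => (h y *m k y) i j) = \sum_l (fun y => h y i l * k y l j).
Proof. by apply/funext => y; rewrite mxE fct_sumE. Qed.

Lemma differentiable_mulmx y : differentiable h y -> differentiable k y ->
  differentiable (fun y => h y *m k y) y.
Proof.
move=> /differentiable_mxP dh /differentiable_mxP dk.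
apply/differentiable_mxP => i j; rewrite mulmx_entryE.
by apply: differentiable_sum => l; apply: differentiableM.
Qed.

Lemma derive_mulmx y v : differentiable h y -> differentiable k y ->
  'D_v (fun y => h y *m k y) y = 'D_v h y *m k y + h y *m 'D_v k y.
Proof.
move=> dh dk; have /differentiable_mxP dh' := dh.
have /differentiable_mxP dk' := dk.
apply/matrixP => i j; rewrite derive_entry; last first.
  exact/diff_derivable/differentiable_mulmx.
rewrite mulmx_entryE derive_sum => [|l]; last first.
  by apply/diff_derivable/differentiableM.
rewrite !mxE -big_split; apply: eq_bigr => l _ /=.
rewrite [LHS]deriveM; [|exact: diff_derivable..].
rewrite !derive_entry; [|exact: diff_derivable..].
by rewrite addrC; congr (_ + _); rewrite [LHS]mulrC.
Qed.

End Product.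

Section Smooth.
Variable U : set V.
Hypothesis oU : open U.

Lemma smooth_on_mxP a b (h : V -> 'M[R]_(a, b)) :
  smooth_on U h <-> forall i j, smooth_on U (fun y => h y i j).
Proof.
have E (h' : V -> 'M[R]_(a, b)) v i j y : smooth_on U h' -> U y ->
    ('D_v h' y) i j = 'D_v (fun y => h' y i j) y.
  by move=> sh Uy; rewrite derive_entry //; exact: smooth_on_derivable sh Uy.
split=> [sh i j|sh].
  pose B (k : V -> R) := exists h' : V -> 'M[R]_(a, b),
    smooth_on U h' /\ k = (fun y => h' y i j).
  apply: (@smooth_on_gen _ _ U B); [exact: oU| |by exists h].
  move=> _ [{}h [{}sh ->]]; split=> [y Uy|v].
    by have /differentiable_mxP := smooth_on_diff sh Uy; apply.
  exists 1%N, (fun _ y => ('D_v h y) i j); split=> [_|y Uy].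
    by exists ('D_v h); split=> //; exact: smooth_on_derive.
  by rewrite big_ord_recl big_ord0 addr0 E.
pose B (h : V -> 'M[R]_(a, b)) := forall i j, smooth_on U (fun y => h y i j).
apply: (@smooth_on_gen _ _ U B) sh; first exact: oU.
move=> {}h sh; have dh y : U y -> differentiable h y.
  by move=> Uy; apply/differentiable_mxP => i j; exact: smooth_on_diff (sh i j) Uy.
split=> // v; exists 1%N, (fun _ => 'D_v h); split=> [_ i j|y Uy]; last first.
  by rewrite big_ord_recl big_ord0 addr0.
apply: smooth_on_eq (smooth_on_derive v (sh i j)) => // y Uy.
by rewrite derive_entry //; exact/diff_derivable/dh.
Qed.

Lemma smooth_on_mulmx a b c (h : V -> 'M[R]_(a, b)) (k : V -> 'M[R]_(b, c)) :
  smooth_on U h -> smooth_on U k -> smooth_on U (fun y => h y *m k y).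
Proof.
move=> /smooth_on_mxP sh /smooth_on_mxP sk; apply/smooth_on_mxP => i j.
under eq_fun do rewrite mxE.
by apply: smooth_on_sum => // l; apply: smooth_onM.
Qed.

Lemma smooth_on_trmx a b (h : V -> 'M[R]_(a, b)) :
  smooth_on U h -> smooth_on U (fun y => (h y)^T).
Proof.
move=> /smooth_on_mxP sh; apply/smooth_on_mxP => i j.
by under eq_fun do rewrite mxE; exact: sh.
Qed.

Lemma smooth_onZ a b (c : V -> R) (h : V -> 'M[R]_(a, b)) :
  smooth_on U c -> smooth_on U h -> smooth_on U (fun y => c y *: h y).
Proof.
move=> sc /smooth_on_mxP sh; apply/smooth_on_mxP => i j.
under eq_fun do rewrite mxE; apply: smooth_onM => //; exact: sh.
Qed.

Lemma smooth_onN a b (h : V -> 'M[R]_(a, b)) :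
  smooth_on U h -> smooth_on U (fun y => - h y).
Proof.
move=> sh; under eq_fun do rewrite -scaleN1r.
by apply: smooth_onZ sh; exact: smooth_on_cst.
Qed.

Lemma smooth_on_det a (h : V -> 'M[R]_a) :
  smooth_on U h -> smooth_on U (fun y => \det (h y)).
Proof.
elim: a h => [|a IH] h sh.
  by under eq_fun do rewrite det_mx00; exact: smooth_on_cst.
under eq_fun do rewrite (expand_det_row _ ord0).
apply: smooth_on_sum => // j; apply: smooth_onM => //; first by move/smooth_on_mxP: sh; apply.
apply: smooth_onM => //; first exact: smooth_on_cst.
apply: IH; apply/smooth_on_mxP => i' j'; under eq_fun do rewrite !mxE.
by move/smooth_on_mxP: sh; apply.
Qed.

Lemma smooth_on_invmx a (h : V -> 'M[R]_a) : smooth_on U h ->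
  (forall y, U y -> h y \in unitmx) -> smooth_on U (fun y => invmx (h y)).
Proof.
move=> sh Uh.
have : smooth_on U (fun y => (\det (h y))^-1 *: \adj (h y)).
  apply: smooth_onZ.
    apply: smooth_onV => //; first exact: smooth_on_det.
    by move=> y /Uh; rewrite unitmxE unitfE.
  apply/smooth_on_mxP => i j; under eq_fun do rewrite mxE.
  apply: smooth_onM => //; first exact: smooth_on_cst.
  apply: smooth_on_det; apply/smooth_on_mxP => i' j'; under eq_fun do rewrite !mxE.
  by move/smooth_on_mxP: sh; apply.
by apply: smooth_on_eq => // y Uy; rewrite /invmx Uh.
Qed.

End Smooth.
End Matrices.

(** * Chain rule and symmetry of second derivatives *)

Lemma derive_comp (V V' W : normedModType R) (h : V -> V') (g : V' -> W) y v :
  differentiable h y -> differentiable g (h y) ->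
  'D_v (fun y => g (h y)) y = 'D_('D_v h y) g (h y).
Proof.
move=> dh dg; rewrite (deriveE _ dh) (deriveE _ dg).
by rewrite -[LHS]/('D_v (g \o h) y) (deriveE _ (differentiable_comp dh dg)) diff_comp.
Qed.

Lemma derive_line (V W : normedModType R) (h : V -> W) z u (s : R) :
  differentiable h (z + s *: u) ->
  is_derive s 1 (fun s : R => h (z + s *: u)) ('D_u h (z + s *: u)).
Proof.
move=> dh; have dl : is_diff s (fun s : R => z + s *: u) ( *:%R ^~ u).
  by rewrite -[X in is_diff _ _ X]add0r; exact: is_diffD.
have dhl : differentiable (fun s : R => h (z + s *: u)) s.
  by apply: (differentiable_comp (f := fun s : R => z + s *: u)).
apply: DeriveDef; first exact: diff_derivable.
rewrite (@derive_comp R V W (fun s : R => z + s *: u)) //.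
by rewrite (@deriveE _ R _ (fun s : R => z + s *: u)) // diff_val scale1r.
Qed.

Lemma mean_value0 (phi dphi : R -> R) (t : R) : 0 <= t ->
  (forall s, 0 <= s <= t -> is_derive s 1 phi (dphi s)) ->
  exists2 c, 0 <= c <= t & phi t - phi 0 = t * dphi c.
Proof.
move=> t0 dp; have [||c] := @MVT_segment _ phi dphi 0 t t0.
- by move=> x; rewrite in_itv /= => /andP[x0 xt]; apply: dp; rewrite !ltW.
- apply: derivable_within_continuous => x; rewrite in_itv /= => xt.
  by have [] := dp x xt.
- by rewrite in_itv /= subr0 mulrC; exists c.
Qed.

Section Schwarz.
Variable V : normedModType R.
Variables (U : set V) (h : V -> R) (y : V).
Hypothesis sh : smooth_on U h.

Let second_difference (t : R) u v :=
  h (y + t *: u + t *: v) - h (y + t *: u) - h (y + t *: v) + h y.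

(** Two mean value theorems: first along u, for the increment of [h] in the direction v, then along
    v, for ['D_u h]. The left side is symmetric in u and v, the right side a priori is not. *)
Lemma second_differenceE (t : R) u v : 0 < t ->
  (forall a b, 0 <= a <= t -> 0 <= b <= t -> U (y + a *: u + b *: v)) ->
  exists a b, [/\ 0 <= a <= t, 0 <= b <= t &
    second_difference t u v = t * t * 'D_v ('D_u h) (y + a *: u + b *: v)].
Proof.
move=> t0 Ut; pose phi s := h (y + t *: v + s *: u) - h (y + s *: u).
have U0 a : 0 <= a <= t -> U (y + a *: u).
  by move=> at0; rewrite -[_ + _]addr0 -[0](scale0r v); apply: Ut => //; rewrite lexx ltW.
have Ut1 a : 0 <= a <= t -> U (y + t *: v + a *: u).
  by move=> at0; rewrite addrAC; apply: Ut => //; rewrite lexx ltW.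
have dphi s : 0 <= s <= t ->
    is_derive s 1 phi ('D_u h (y + t *: v + s *: u) - 'D_u h (y + s *: u)).
  move=> st; apply: is_deriveB; apply: derive_line; apply: smooth_on_diff sh _.
    exact: Ut1.
  exact: U0.
have [a a0t] := mean_value0 (ltW t0) dphi.
pose psi s := 'D_u h (y + a *: u + s *: v).
have dpsi s : 0 <= s <= t -> is_derive s 1 psi ('D_v ('D_u h) (y + a *: u + s *: v)).
  move=> st; apply: derive_line; apply: smooth_on_diff (smooth_on_derive u sh) _.
  exact: Ut.
have [b b0t] := mean_value0 (ltW t0) dpsi.
rewrite /psi scale0r addr0 [_ + a *: u + _]addrAC => E1 E2; exists a, b; split=> //.
rewrite -mulrA -E1 -E2 /phi /second_difference !scale0r !addr0.
by rewrite [y + t *: v + _]addrAC opprB addrA [RHS]addrAC.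
Qed.

End Schwarz.

(** The points [p] and [q] are allowed to differ because the mean value theorem gives different
    intermediate points for the two orders of derivation. *)
Lemma continuous_eq_near (V : normedModType R) (A B : V -> R) y :
  {for y, continuous A} -> {for y, continuous B} ->
  (forall d, 0 < d -> exists p q, [/\ ball y d p, ball y d q & A p = B q]) ->
  A y = B y.
Proof.
move=> /cvgrPdist_lt cA /cvgrPdist_lt cB H.
apply/eqP; rewrite -subr_eq0 -normr_le0; apply/ler_addgt0Pl => e e0.
have e20 : 0 < e / 2 by rewrite divr_gt0.
have /nbhs_ballP[d /= d0 Hd] :
    \forall z \near y, `|A y - A z| < e / 2 /\ `|B y - B z| < e / 2.
  exact: filterI (cA _ e20) (cB _ e20).
have [p [q [/Hd[H1 _] /Hd[_ H2] E]]] := H d d0.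
rewrite addr0 -(subrKA (A p)) (le_trans (ler_normD _ _)) //.
by rewrite [leRHS]splitr lerD ?ltW // E distrC.
Qed.

Lemma schwarz (V : normedModType R) (U : set V) (h : V -> R) y u v :
  open U -> smooth_on U h -> U y -> 'D_u ('D_v h) y = 'D_v ('D_u h) y.
Proof.
move=> oU sh Uy; apply: (@continuous_eq_near _ ('D_u ('D_v h)) ('D_v ('D_u h))).
- apply/differentiable_continuous/smooth_on_diff/Uy.
  exact/smooth_on_derive/smooth_on_derive.
- apply/differentiable_continuous/smooth_on_diff/Uy.
  exact/smooth_on_derive/smooth_on_derive.
move=> d d0; have /nbhs_ballP[d' /= d'0 Hd'] := open_near oU Uy.
(* The added 1 keeps [c] positive when u = v = 0 and makes t (|u| + |v|) strictly smaller than the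
   radius. *)
pose c : R := `|u| + `|v| + 1; have c0 : 0 < c by rewrite ltr_wpDl // addr_ge0.
pose t := Num.min d d' / c; have t0 : 0 < t by rewrite divr_gt0 // lt_min d0.
have near_y a b : 0 <= a <= t -> 0 <= b <= t ->
    ball y (Num.min d d') (y + a *: u + b *: v).
  move=> /andP[a0 at_] /andP[b0 bt]; rewrite -ball_normE /= -addrA opprD addrA.
  rewrite subrr add0r normrN (le_lt_trans (ler_normD _ _)) // !normrZ.
  rewrite !ger0_norm // (@le_lt_trans _ _ (t * (`|u| + `|v|))) //.
    by rewrite mulrDr lerD // ler_wpM2r.
  by rewrite /t mulrAC ltr_pdivrMr // ltr_pM2l ?ltrDl // lt_min d0.
have Ut a b : 0 <= a <= t -> 0 <= b <= t -> U (y + a *: u + b *: v).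
  move=> ha hb; apply: Hd'; apply: le_ball (near_y _ _ ha hb).
  by rewrite ge_min lexx orbT.
have Ut' a b : 0 <= a <= t -> 0 <= b <= t -> U (y + a *: v + b *: u).
  by move=> ha hb; rewrite addrAC; apply: Ut.
have [a [b [ha hb E1]]] := second_differenceE sh t0 Ut.
have [a' [b' [ha' hb' E2]]] := second_differenceE sh t0 Ut'.
(* The first point comes from the second difference in the order v, u, the other from the order u,
   v; both values times t^2 are the same second difference. *)
exists (y + b' *: u + a' *: v), (y + a *: u + b *: v); split.
- by apply: le_ball (near_y _ _ hb' ha'); rewrite ge_min lexx.
- by apply: le_ball (near_y _ _ ha hb); rewrite ge_min lexx.
apply: (mulfI (lt0r_neq0 (mulr_gt0 t0 t0))).
apply: etrans _ E1; rewrite (addrAC y (b' *: u)); apply: etrans (esym E2) _.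
rewrite (addrAC y (t *: v)).
by congr (_ + _); rewrite (addrAC (h _) (- h (y + t *: v))).
Qed.

(** * Functions of coordinates: composition and Jacobians *)

Section Coordinates.
Variable n : nat.
Implicit Types u v : 'rV[R]_n.

Lemma derive_coord (W : normedModType R) (h : 'rV[R]_n -> W) y v :
  differentiable h y -> 'D_v h y = \sum_i v 0 i *: 'D_(delta_mx 0 i) h y.
Proof.
move=> dh; rewrite deriveE // {1}(row_sum_delta v) linear_sum /=.
by apply: eq_bigr => i _; rewrite linearZ deriveE.
Qed.

(** The family a * (g \o h) is used with a factor [a] because the chain rule multiplies each (D_j g)
    \o h by the j-th component of ['D_v h]. *)
Lemma smooth_on_comp_fun (V : normedModType R) (U : set V) (U' : set 'rV[R]_n)
    (h : V -> 'rV[R]_n) (g : 'rV[R]_n -> R) :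
  open U -> (forall y, U y -> U' (h y)) -> smooth_on U h -> smooth_on U' g ->
  smooth_on U (fun y => g (h y)).
Proof.
move=> oU hU sh sg; pose B (k : V -> R) := exists (a : V -> R) (g : 'rV[R]_n -> R),
  [/\ smooth_on U a, smooth_on U' g & k = (fun y => a y * g (h y))].
apply: (@smooth_on_gen _ _ U B); [exact: oU| |exists (cst 1), g]; last first.
  by split=> //; [exact: smooth_on_cst|apply/funext => y; rewrite mul1r].
move=> _ [a [{sg}g [sa sg ->]]].
have dgh y : U y -> differentiable (fun y => g (h y)) y.
  move=> Uy; apply: (@differentiable_comp _ _ _ _ h g).
    exact: smooth_on_diff sh Uy.
  exact/(smooth_on_diff sg)/hU.
split=> [y Uy|v].
  by apply: differentiableM; [exact: smooth_on_diff sa Uy|exact: dgh].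
(* Index 0 carries the derivative of [a], index j + 1 the j-th partial derivative of [g]. *)
exists n.+1, (fun i y => if unlift ord0 i is Some j then
  (a y * ('D_v h y) 0 j) * 'D_(delta_mx 0 j) g (h y) else 'D_v a y * g (h y)).
split=> [i|y Uy].
  case: (unlift ord0 i) => [j|].
    exists (fun y => a y * ('D_v h y) 0 j), ('D_(delta_mx 0 j) g).
    split=> //; last exact: smooth_on_derive.
    apply: smooth_onM => //.
    by have /(smooth_on_mxP oU) := smooth_on_derive v sh; apply.
  by exists ('D_v a), g; split=> //; exact: smooth_on_derive.
rewrite big_ord_recl unlift_none [LHS]deriveM; last 2 first.
- exact: smooth_on_derivable sa Uy.
- exact/diff_derivable/dgh.
rewrite addrC; congr (_ + _); first by rewrite [LHS]mulrC.
rewrite derive_comp; last 2 first.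
- exact: smooth_on_diff sh Uy.
- exact/(smooth_on_diff sg)/hU.
rewrite derive_coord; last exact/(smooth_on_diff sg)/hU.
rewrite scaler_sumr; apply: eq_bigr => j _; rewrite liftK.
by rewrite [LHS]mulrA.
Qed.

Lemma smooth_on_comp (V : normedModType R) (U : set V) (U' : set 'rV[R]_n) a b
    (h : V -> 'rV[R]_n) (g : 'rV[R]_n -> 'M[R]_(a, b)) :
  open U -> open U' -> (forall y, U y -> U' (h y)) ->
  smooth_on U h -> smooth_on U' g -> smooth_on U (fun y => g (h y)).
Proof.
move=> oU oU' hU sh /(smooth_on_mxP oU') sg; apply/(smooth_on_mxP oU) => i j.
exact: (smooth_on_comp_fun oU hU sh (sg i j)).
Qed.

(** The direction varies with the point, whereas smoothness only speaks of fixed directions;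
    expanding [X y] over the standard basis reduces to these. *)
Lemma smooth_on_directional (U : set 'rV[R]_n) a b (X : 'rV[R]_n -> 'rV[R]_n)
    (h : 'rV[R]_n -> 'M[R]_(a, b)) :
  open U -> smooth_on U X -> smooth_on U h -> smooth_on U (fun y => 'D_(X y) h y).
Proof.
move=> oU sX sh.
apply: (@smooth_on_eq _ _ _ (fun y => \sum_i X y 0 i *: 'D_(delta_mx 0 i) h y)) => //.
  by move=> y Uy; rewrite [RHS]derive_coord //; exact: smooth_on_diff sh Uy.
apply: smooth_on_sum => // i; apply: smooth_onZ => //; last exact: smooth_on_derive.
by move/(smooth_on_mxP oU): sX; apply.
Qed.

Section Jacobian.
Variables (m : nat) (U : set 'rV[R]_n) (F : 'rV[R]_n -> 'rV[R]_m).
Hypotheses (oU : open U) (sF : smooth_on U F).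

Lemma jacobian_row y i : U y -> row i ('J F y) = 'D_(delta_mx 0 i) F y.
Proof.
by move=> Uy; rewrite deriveEjacobian ?rowE //; exact: smooth_on_diff sF Uy.
Qed.

Lemma smooth_on_jacobian : smooth_on U (jacobian F).
Proof.
apply/(smooth_on_mxP oU) => i j.
have /(smooth_on_mxP oU)/(_ 0 j) := smooth_on_derive (delta_mx 0 i) sF.
by apply: smooth_on_eq => // y Uy; rewrite -jacobian_row // mxE.
Qed.

(** Schwarz's theorem in matrix form: v times the derivative of the Jacobian along u is
    ['D_u ('D_v F)]. Both the pullback law and the symmetry of B rest on it. *)
Lemma derive_jacobianC y u v : U y ->
  v *m 'D_u (jacobian F) y = u *m 'D_v (jacobian F) y.
Proof.
move=> Uy; have D w z : U z -> w *m 'J F z = 'D_w F z.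
  by move=> Uz; rewrite deriveEjacobian //; exact: smooth_on_diff sF Uz.
have E w w' : w *m 'D_w' (jacobian F) y = 'D_w' ('D_w F) y.
  have dJ : differentiable (jacobian F) y by exact: smooth_on_diff smooth_on_jacobian Uy.
  (* The zero derivative of the constant [w] is inserted so that the product rule can be folded. *)
  rewrite -[LHS]add0r -(mul0mx _ ('J F y)) -(derive_cst w y w').
  rewrite -derive_mulmx //; apply: near_eq_derive.
  by apply: eq_on_near oU Uy _ => z /D.
have S w w' i j : ('D_w ('D_w' F) y) i j = 'D_w ('D_w' (fun z => F z i j)) y.
  rewrite derive_entry; last first.
    by apply: smooth_on_derivable Uy; exact: smooth_on_derive.
  apply: near_eq_derive; apply: eq_on_near oU Uy _ => z Uz.
  by rewrite derive_entry //; exact: smooth_on_derivable sF Uz.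
rewrite !E; apply/matrixP => i j.
apply: etrans (S u v i j) _; apply: etrans _ (esym (S v u i j)).
by apply: (schwarz (U := U)) => //; move/(smooth_on_mxP oU): sF; apply.
Qed.

End Jacobian.

Lemma jacobian_comp m p (F : 'rV[R]_n -> 'rV[R]_m) (G : 'rV[R]_m -> 'rV[R]_p) y :
  differentiable F y -> differentiable G (F y) ->
  'J (G \o F) y = 'J F y *m 'J G (F y).
Proof.
move=> dF dG; apply/row_matrixP => i; rewrite row_mul !rowE.
rewrite -(deriveEjacobian _ (differentiable_comp dF dG)).
rewrite -(deriveEjacobian _ dF) -(deriveEjacobian _ dG).
exact: derive_comp.
Qed.

Lemma near_eq_jacobian m (F G : 'rV[R]_n -> 'rV[R]_m) y :
  differentiable F y -> (\near y, F y = G y) -> 'J F y = 'J G y.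
Proof.
move=> dF FG; apply/row_matrixP => i; rewrite [LHS]rowE [RHS]rowE.
apply: etrans (esym (deriveEjacobian _ dF)) _.
apply: etrans _ (deriveEjacobian _ (near_eq_differentiable FG dF)).
exact: near_eq_derive.
Qed.

Lemma jacobian_id (y : 'rV[R]_n) : 'J idfun y = 1%:M.
Proof.
apply/row_matrixP => i; rewrite [LHS]rowE [RHS]rowE mulmx1.
by rewrite -deriveEjacobian // derive_id.
Qed.

End Coordinates.

End SmoothCalculus.

(** * Christoffel symbols *)

Section ChristoffelForms.
Variable R : realType.

Lemma trmx11 (A : 'M[R]_1) : A^T = A.
Proof. by apply/matrixP => i j; rewrite mxE !ord1. Qed.

Lemma eq_bilinear_mx m n (A B : 'M[R]_(m, n)) :
  (forall (v : 'rV_m) (w : 'rV_n), v *m A *m w^T = v *m B *m w^T) -> A = B.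
Proof.
move=> AB; apply/matrixP => i j; have := AB (delta_mx 0 i) (delta_mx 0 j).
by rewrite -!rowE trmx_delta -!colE => /matrixP/(_ 0 0); rewrite !mxE.
Qed.

(* The Christoffel symbols of the first kind: entry (j, k) is \sum_i u^i [ij, k]. *)
Definition lowered_form n (G : 'rV[R]_n -> 'M[R]_n) (y u : 'rV[R]_n) : 'M[R]_n :=
  let S := \matrix_(j, k) (u *m 'D_(delta_mx 0 j) G y) 0 k in
  2^-1 *: ('D_u G y + S - S^T).

(** Raising the last index gives the Christoffel symbols of the second kind, contracted with [u]. *)
Definition connection_form n (G : 'rV[R]_n -> 'M[R]_n) (y u : 'rV[R]_n) : 'M[R]_n :=
  lowered_form G y u *m invmx (G y).

Section OneForm.
Variables (n : nat) (U : set 'rV[R]_n) (G : 'rV[R]_n -> 'M[R]_n).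
Hypotheses (oU : open U) (sG : smooth_on U G).
Hypothesis symG : forall y, U y -> (G y)^T = G y.

Lemma derive_form_sym y u : U y -> ('D_u G y)^T = 'D_u G y.
Proof.
move=> Uy; rewrite -derive_trmx; last exact: smooth_on_diff sG Uy.
by apply: near_eq_derive; apply: eq_on_near oU Uy _ => z /symG.
Qed.

(** Koszul formula for constant fields u, v, w, whose brackets vanish. *)
Lemma lowered_formE y u v w : U y ->
  v *m lowered_form G y u *m w^T = 2^-1 *:
    (v *m 'D_u G y *m w^T + u *m 'D_v G y *m w^T - u *m 'D_w G y *m v^T).
Proof.
move=> Uy; rewrite /lowered_form; set S := \matrix_(j, k) _.
have vS v' : v' *m S = u *m 'D_v' G y.
  rewrite (derive_coord _ (smooth_on_diff sG Uy)) mulmx_sumr.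
  apply/rowP => k; rewrite mxE summxE; apply: eq_bigr => j _.
  by rewrite -scalemxAr !mxE.
rewrite -scalemxAr -scalemxAl; congr (_ *: _).
rewrite !(mulmxDr, mulmxDl, mulmxN, mulNmx) vS; congr (_ + _ - _).
by rewrite -[LHS]trmx11 !trmx_mul !trmxK mulmxA vS.
Qed.

(** S - S^T is antisymmetric and ['D_u G] symmetric, so only the latter survives in the sum with the
    transpose. *)
Lemma lowered_form_metric y u : U y ->
  'D_u G y = lowered_form G y u + (lowered_form G y u)^T.
Proof.
move=> Uy; rewrite /lowered_form; set S := \matrix_(j, k) _.
apply/matrixP => i j; have /matrixP/(_ i j) := derive_form_sym u Uy.
by rewrite !mxE; lra.
Qed.

Lemma smooth_on_lowered (X : 'rV[R]_n -> 'rV[R]_n) : smooth_on U X ->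
  smooth_on U (fun y => lowered_form G y (X y)).
Proof.
move=> sX; rewrite /lowered_form.
have sS : smooth_on U (fun y => \matrix_(j, k) (X y *m 'D_(delta_mx 0 j) G y) 0 k : 'M[R]_n).
  apply/(smooth_on_mxP oU) => j k; under eq_fun do rewrite mxE.
  have /(smooth_on_mxP oU) : smooth_on U (fun y => X y *m 'D_(delta_mx 0 j) G y).
    by apply: smooth_on_mulmx => //; exact: smooth_on_derive.
  exact.
apply: smooth_onZ => //; first exact: smooth_on_cst.
apply: smooth_onD => //; last by apply/smooth_onN/smooth_on_trmx.
by apply: smooth_onD => //; exact: smooth_on_directional.
Qed.

Hypothesis unitG : forall y, U y -> G y \in unitmx.

Lemma connection_formK y u : U y -> connection_form G y u *m G y = lowered_form G y u.
Proof. by move=> Uy; rewrite mulmxKV ?unitG. Qed.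

Lemma smooth_on_connection (X : 'rV[R]_n -> 'rV[R]_n) : smooth_on U X ->
  smooth_on U (fun y => connection_form G y (X y)).
Proof.
by move=> sX; apply: smooth_on_mulmx; [|exact: smooth_on_lowered|exact: smooth_on_invmx].
Qed.

Lemma connection_form_metric y u : U y ->
  'D_u G y = connection_form G y u *m G y + G y *m (connection_form G y u)^T.
Proof.
move=> Uy; rewrite lowered_form_metric // -connection_formK //.
by rewrite trmx_mul symG.
Qed.

End OneForm.

(** [Au] stands for the derivative of the Jacobian J along u, [Bu] for that of the metric along u J,
    and the hypotheses on them for the symmetry of second derivatives. Of the six terms with a
    second derivative, four cancel in pairs and two agree, which absorbs the factor 1/2. *)
Lemma koszul_pullback m n (J Au Av Aw : 'M[R]_(m, n)) (g Bu Bv Bw : 'M[R]_n)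
    (u v w : 'rV[R]_m) : g^T = g ->
  v *m Au = u *m Av -> w *m Au = u *m Aw -> w *m Av = v *m Aw ->
  2^-1 *: (v *m (Au *m g *m J^T + J *m Bu *m J^T + J *m g *m Au^T) *m w^T
         + u *m (Av *m g *m J^T + J *m Bv *m J^T + J *m g *m Av^T) *m w^T
         - u *m (Aw *m g *m J^T + J *m Bw *m J^T + J *m g *m Aw^T) *m v^T) =
  2^-1 *: (v *m J *m Bu *m (w *m J)^T + u *m J *m Bv *m (w *m J)^T
         - u *m J *m Bw *m (v *m J)^T) + v *m Au *m g *m (w *m J)^T.
Proof.
move=> gT uv uw vw; have E (a b : 'rV_m) A B :
    a *m (A *m g *m J^T + J *m B *m J^T + J *m g *m A^T) *m b^T =
    a *m A *m g *m (b *m J)^T + a *m J *m B *m (b *m J)^T + a *m J *m g *m (b *m A)^T.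
  by rewrite !mulmxDr !mulmxDl !trmx_mul !mulmxA.
rewrite !E uv uw vw.
have -> : v *m J *m g *m (u *m Aw)^T = u *m Aw *m g *m (v *m J)^T.
  by rewrite -[LHS]trmx11 !(trmx_mul, trmxK) gT !mulmxA.
apply/matrixP => i j; rewrite !mxE; lra.
Qed.

Section Pullback.
Variables (m n : nat) (U : set 'rV[R]_m) (U' : set 'rV[R]_n).
Variables (F : 'rV[R]_m -> 'rV[R]_n) (G : 'rV[R]_n -> 'M[R]_n).
Hypotheses (oU : open U) (oU' : open U') (FU : forall y, U y -> U' (F y)).
Hypotheses (sF : smooth_on U F) (sG : smooth_on U' G).
Hypothesis symG : forall y, U' y -> (G y)^T = G y.

Definition pullback_form y : 'M[R]_m := 'J F y *m G (F y) *m ('J F y)^T.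

Lemma smooth_on_pullback : smooth_on U pullback_form.
Proof.
have sJ := smooth_on_jacobian oU sF.
apply: smooth_on_mulmx => //; last exact: smooth_on_trmx.
by apply: smooth_on_mulmx => //; exact: smooth_on_comp sF sG.
Qed.

Lemma derive_pullback y u : U y ->
  'D_u pullback_form y = 'D_u (jacobian F) y *m G (F y) *m ('J F y)^T
     + 'J F y *m 'D_(u *m 'J F y) G (F y) *m ('J F y)^T
     + 'J F y *m G (F y) *m ('D_u (jacobian F) y)^T.
Proof.
move=> Uy; have dJ := smooth_on_diff (smooth_on_jacobian oU sF) Uy.
have dF := smooth_on_diff sF Uy; have dG := smooth_on_diff sG (FU Uy).
have dGF : differentiable (fun z => G (F z)) y by exact: (differentiable_comp dF dG).
have dJG : differentiable (fun z => 'J F z *m G (F z)) y by exact: differentiable_mulmx.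
rewrite /pullback_form (derive_mulmx _ dJG) ?derive_mulmx ?derive_trmx //; last first.
  exact: differentiable_trmx.
by rewrite (derive_comp _ dF dG) -deriveEjacobian // mulmxDl.
Qed.

Lemma lowered_form_pullback y u : U y ->
  lowered_form pullback_form y u =
    'J F y *m lowered_form G (F y) (u *m 'J F y) *m ('J F y)^T
    + 'D_u (jacobian F) y *m G (F y) *m ('J F y)^T.
Proof.
move=> Uy; apply: eq_bilinear_mx => v w.
rewrite (lowered_formE smooth_on_pullback) // !derive_pullback //.
have C a b := derive_jacobianC oU sF a b Uy.
have -> : v *m ('J F y *m lowered_form G (F y) (u *m 'J F y) *m ('J F y)^T +
      'D_u (jacobian F) y *m G (F y) *m ('J F y)^T) *m w^T =
    (v *m 'J F y) *m lowered_form G (F y) (u *m 'J F y) *m (w *m 'J F y)^T +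
    v *m 'D_u (jacobian F) y *m G (F y) *m (w *m 'J F y)^T.
  by rewrite mulmxDr mulmxDl trmx_mul !mulmxA.
rewrite (lowered_formE sG) ?FU //.
apply: koszul_pullback; [exact/symG/FU|exact: C..].
exact: FU.
Qed.

Hypothesis unitG : forall y, U' y -> G y \in unitmx.

(* Gauss formula: the difference of the two connections along F is normal to F. *)
Lemma connection_form_pullback y u : U y -> pullback_form y \in unitmx ->
  ('D_u (jacobian F) y + 'J F y *m connection_form G (F y) (u *m 'J F y)
    - connection_form pullback_form y u *m 'J F y) *m G (F y) *m ('J F y)^T = 0.
Proof.
move=> Uy uH; rewrite !(mulmxDl, mulNmx).
(* The product J G J^T is the pullback metric itself and cancels the inverse inside
   [connection_form]. *)
have -> : connection_form pullback_form y u *m 'J F y *m G (F y) *m ('J F y)^T =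
    lowered_form pullback_form y u.
  by rewrite -!mulmxA mulmxA [X in _ *m X]mulmxA mulmxKV.
have -> : 'J F y *m connection_form G (F y) (u *m 'J F y) *m G (F y) *m ('J F y)^T =
    'J F y *m lowered_form G (F y) (u *m 'J F y) *m ('J F y)^T.
  by rewrite -[_ *m _ *m G (F y)]mulmxA mulmxKV //; exact/unitG/FU.
by rewrite lowered_form_pullback // [X in X - _]addrC subrr.
Qed.

End Pullback.

(** With an invertible Jacobian only 0 is normal to F, so the Gauss formula becomes an equality: the
    transformation law of Christoffel symbols. *)
Lemma connection_form_chart n (U U' : set 'rV[R]_n) F G (y u : 'rV[R]_n) :
  open U -> open U' -> (forall y, U y -> U' (F y)) -> smooth_on U F ->
  smooth_on U' G -> (forall y, U' y -> (G y)^T = G y) ->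
  (forall y, U' y -> G y \in unitmx) -> U y -> 'J F y \in unitmx ->
  connection_form (pullback_form F G) y u *m 'J F y =
    'D_u (jacobian F) y + 'J F y *m connection_form G (F y) (u *m 'J F y).
Proof.
move=> oU oU' FU sF sG symG unitG Uy uJ.
have uH : pullback_form F G y \in unitmx.
  by rewrite !unitmx_mul unitmx_tr uJ unitG //; exact: FU.
have := connection_form_pullback oU oU' FU sF sG symG unitG u Uy uH.
move=> /(congr1 (mulmx^~ (invmx ('J F y)^T))); rewrite mul0mx mulmxK ?unitmx_tr //.
move=> /(congr1 (mulmx^~ (invmx (G (F y))))); rewrite mul0mx mulmxK; last exact/unitG/FU.
by move/eqP; rewrite subr_eq0 => /eqP.
Qed.

End ChristoffelForms.

(** * Charts *)

Section Charts.
Variable R : realType.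

Section Chart.
Variables (n : nat) (T : topologicalType) (c : chart R n T).

Lemma cinv_cvg x : cdom c x -> cinv c @ c x --> x.
Proof.
move=> cx; have : {for c x, continuous (cinv c)} by apply: cinv_cts; exists x.
by rewrite /prop_for /continuous_at cmapK.
Qed.

Lemma chart_near (P : T -> Prop) x : cdom c x ->
  (\near x, P x) -> \forall y \near c x, P (cinv c y).
Proof. by move=> cx; exact: cinv_cvg. Qed.

Lemma chart_nearK x : cdom c x -> \forall y \near c x, c (cinv c y) = y.
Proof.
move=> cx; have : nbhs (c x) (c @` cdom c).
  by apply: open_nbhs_nbhs; split; [exact: cimg_open|exists x].
by apply: filterS => y [x' cx' <-]; rewrite cmapK.
Qed.

Lemma chart_near_dom x : cdom c x -> \near x, cdom c x.
Proof. by move=> cx; apply: open_nbhs_nbhs; split=> //; exact: cdom_open. Qed.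

Lemma open_chart_image (A : set T) : open A -> open (c @` (cdom c `&` A)).
Proof.
move=> oA; rewrite openE => _ [x [cx Ax] <-]; rewrite /interior.
have H : \near x, cdom c x /\ A x.
  by apply: filterI; [exact: chart_near_dom|exact: open_nbhs_nbhs].
apply: filterS2 (chart_nearK cx) (chart_near cx H) => y yK H'.
by exists (cinv c y).
Qed.

End Chart.

Section Local.
Variables (m n : nat) (M : manifold R m) (P : manifold R n).
Implicit Type f : M -> P.

Definition local_map f (q : M) (r : P) : 'rV[R]_m -> 'rV[R]_n :=
  phi r \o f \o cinv (phi q).

Definition dlocal f q r (x : M) : 'M[R]_(m, n) := 'J (local_map f q r) (phi q x).

Definition local_dom f (O : set M) q r : set 'rV[R]_m :=
  phi q @` (cdom (phi q) `&` O `&` f @^-1` cdom (phi r)).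

Lemma open_local_dom f O q r : continuous f -> open O -> open (local_dom f O q r).
Proof.
move=> cf oO; rewrite /local_dom -setIA; apply: open_chart_image.
by apply: openI => //; move/continuousP: cf; apply; exact: cdom_open.
Qed.

Lemma local_mapE f q r x : cdom (phi q) x ->
  local_map f q r (phi q x) = phi r (f x).
Proof. by move=> qx; rewrite /local_map /= cmapK. Qed.

Lemma smooth_local_map f O q r : smooth_map f ->
  smooth_on (local_dom f O q r) (local_map f q r).
Proof.
move=> [_ sf]; apply: smooth_on_sub (sf q r) => _ [x [[qx _] fx] <-].
by exists x.
Qed.

Lemma differentiable_local_map f q r x : smooth_map f -> cdom (phi q) x ->
  cdom (phi r) (f x) -> differentiable (local_map f q r) (phi q x).
Proof.
move=> sf qx fx; apply: smooth_on_diff (@smooth_local_map f setT q r sf) _.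
by exists x.
Qed.

End Local.

Lemma smooth_map_id m (M : manifold R m) : smooth_map (@idfun M).
Proof. by split=> [x|q r]; [exact: cvg_id|exact: (phi_smooth q r)]. Qed.

Lemma dlocal_comp l m n (M : manifold R l) (P : manifold R m) (Q : manifold R n)
    (f : M -> P) (g : P -> Q) q r s x :
  smooth_map f -> smooth_map g ->
  cdom (phi q) x -> cdom (phi r) (f x) -> cdom (phi s) (g (f x)) ->
  dlocal (g \o f) q s x = dlocal f q r x *m dlocal g r s (f x).
Proof.
move=> sf sg qx rx sx; rewrite /dlocal -(local_mapE f r qx) -jacobian_comp.
(* The composite read in charts factors through the chart [phi r] only while f stays in its domain,
   hence only near [phi q x]. *)
- symmetry; apply: near_eq_jacobian.
    apply: differentiable_comp; first exact: differentiable_local_map.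
    by rewrite local_mapE //; exact: differentiable_local_map.
  have : \near x, cdom (phi r) (f x) by exact: (sf.1 x) (chart_near_dom rx).
  by move/(chart_near qx); apply: filterS => y ry; rewrite /local_map /= cmapK.
- exact: differentiable_local_map.
- by rewrite local_mapE //; exact: differentiable_local_map.
Qed.

Section Transition.
Variables (n : nat) (P : manifold R n).
Implicit Types p q r s : P.

(** A change of charts is the identity map read in two charts, so [dlocal_comp] yields the cocycle
    rule for [chg]. *)
Lemma chg_dlocal q r p : chg q r p = dlocal (@idfun P) q r p.
Proof. by []. Qed.

Lemma chg_comp q r s p : cdom (phi q) p -> cdom (phi r) p -> cdom (phi s) p ->
  chg q r p *m chg r s p = chg q s p.
Proof.
move=> qp rp sp; rewrite !chg_dlocal -dlocal_comp //; exact: smooth_map_id.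
Qed.

Lemma chg_id q p : cdom (phi q) p -> chg q q p = 1%:M.
Proof.
move=> qp; rewrite -(jacobian_id (phi q p)); symmetry; apply: near_eq_jacobian => //.
by apply: filterS (chart_nearK qp).
Qed.

Lemma chg_unit q r p : cdom (phi q) p -> cdom (phi r) p -> chg q r p \in unitmx.
Proof.
move=> qp rp.
exact: (mulmx1_unit (etrans (chg_comp qp rp qp) (chg_id qp))).1.
Qed.

End Transition.

Section LocalDifferential.
Variables (m n : nat) (M : manifold R m) (P : manifold R n) (f : M -> P).
Hypothesis sf : smooth_map f.

Lemma chg_dlocal_chg q q' r r' x : cdom (phi q) x -> cdom (phi q') x ->
  cdom (phi r) (f x) -> cdom (phi r') (f x) ->
  chg q q' x *m dlocal f q' r x *m chg r r' (f x) = dlocal f q r' x.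
Proof.
move=> qx qx' rx rx'; rewrite !chg_dlocal.
rewrite -(@dlocal_comp _ _ _ _ _ _ idfun f) //; last exact: smooth_map_id.
by rewrite -(@dlocal_comp _ _ _ _ _ _ (f \o idfun) idfun) //; exact: smooth_map_id.
Qed.

Lemma dlocalE q r x : cdom (phi q) x -> cdom (phi r) (f x) ->
  dlocal f q r x = chg q x x *m dmap f x *m chg (f x) r (f x).
Proof. by move=> qx rx; rewrite -(chg_dlocal_chg qx (phi_dom x) (phi_dom _) rx). Qed.

Lemma coord_along_chg r r' (N : M -> 'rV[R]_n) x :
  cdom (phi r) (f x) -> cdom (phi r') (f x) ->
  coord_along f r' N x = coord_along f r N x *m chg r r' (f x).
Proof. by move=> rx rx'; rewrite /coord_along -mulmxA chg_comp //; exact: phi_dom. Qed.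

Lemma coord_along_self (N : M -> 'rV[R]_n) x : coord_along f (f x) N x = N x.
Proof. by rewrite /coord_along chg_id ?mulmx1 //; exact: phi_dom. Qed.

End LocalDifferential.

End Charts.

(** * The covariant derivative in charts *)

Section Connections.
Variable R : realType.

Lemma connection_form_near_eq n (G G' : 'rV[R]_n -> 'M[R]_n) y u :
  (\near y, G y = G' y) -> connection_form G y u = connection_form G' y u.
Proof.
move=> GG'; have D : derive G y = derive G' y.
  by apply/funext => v; exact: near_eq_derive.
have Gy : G y = G' y by exact: nbhs_singleton GG'.
have L : lowered_form G y u = lowered_form G' y u.
  exact: (congr1 (fun D : 'rV[R]_n -> 'M[R]_n =>
    let S := \matrix_(j, k) (u *m D (delta_mx 0 j)) 0 k in 2^-1 *: (D u + S - S^T)) D).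
by rewrite /connection_form L Gy.
Qed.

Lemma lowered_form_entry n (G : 'rV[R]_n -> 'M[R]_n) y u j l :
  differentiable G y ->
  lowered_form G y u j l = 2^-1 * \sum_i u 0 i *
    (('D_(delta_mx 0 i) G y) j l + ('D_(delta_mx 0 j) G y) i l
     - ('D_(delta_mx 0 l) G y) i j).
Proof.
move=> dG; have Du : ('D_u G y) j l = \sum_i u 0 i * ('D_(delta_mx 0 i) G y) j l.
  by rewrite (derive_coord u dG) summxE; apply: eq_bigr => i _; rewrite mxE.
rewrite /lowered_form; move: (derive G y) Du => D Du.
rewrite !mxE Du -big_split -sumrB; congr (_ * _); apply: eq_bigr => i _.
by rewrite mulrBr mulrDr.
Qed.

Section Metric.
Variables (n : nat) (P : manifold R n) (g : P -> 'M[R]_n).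
Hypothesis hg : riemannian g.
Implicit Types p q r : P.

Lemma metric_unit p : g p \in unitmx.
Proof.
rewrite -row_free_unit -kermx_eq0; apply/negPn/negP => /rowV0Pn[u].
move=> /sub_kermxP ug u0; have := metric_pos hg p u0.
by rewrite /ip ug mul0mx mxE ltxx.
Qed.

Definition form_chart r : 'rV[R]_n -> 'M[R]_n := form_coord r g \o cinv (phi r).

Lemma form_chartE r p : cdom (phi r) p -> form_chart r (phi r p) = form_coord r g p.
Proof. by move=> rp; rewrite /form_chart /= cmapK. Qed.

Lemma form_chart_sym r y : (form_chart r y)^T = form_chart r y.
Proof. by rewrite /form_chart /= /form_coord !trmx_mul trmxK (Defs.metric_sym hg) mulmxA. Qed.

Lemma form_coord_unit r p : cdom (phi r) p -> form_coord r g p \in unitmx.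
Proof.
move=> rp; rewrite /form_coord !unitmx_mul unitmx_tr metric_unit.
by rewrite (chg_unit rp (phi_dom p)).
Qed.

Lemma form_chart_unit r y : (phi r @` cdom (phi r)) y -> form_chart r y \in unitmx.
Proof. by move=> [p rp <-]; rewrite form_chartE //; exact: form_coord_unit. Qed.

Lemma form_coord_self p : form_coord p g p = g p.
Proof. by rewrite /form_coord chg_id ?mul1mx ?trmx1 ?mulmx1 //; exact: phi_dom. Qed.

Lemma form_coord_chg q r p : cdom (phi q) p -> cdom (phi r) p ->
  form_coord q g p = chg q r p *m form_coord r g p *m (chg q r p)^T.
Proof.
move=> qp rp; rewrite /form_coord -(chg_comp qp rp (phi_dom p)).
by rewrite trmx_mul !mulmxA.
Qed.

(** Links the indexed sums that define [conn] to the matrix calculus: the metric in the chart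
    [phi p] has value [g p] at p, as [chg p p p] is the identity. *)
Lemma conn_connection_form p v :
  conn g p v = connection_form (form_chart p) (phi p p) v.
Proof.
have dG : differentiable (form_chart p) (phi p p).
  by apply: smooth_on_diff (metric_smooth hg p) _; exists p => //; exact: phi_dom.
have E i j l : dmetric g p i j l = ('D_(delta_mx 0 i) (form_chart p) (phi p p)) j l.
  by rewrite derive_entry //; exact: diff_derivable.
apply/matrixP => j k; rewrite /connection_form form_chartE ?form_coord_self; last exact: phi_dom.
rewrite !mxE; under eq_bigr => i _ do rewrite /christoffel mulrCA mulr_sumr.
rewrite -mulr_sumr exchange_big mulr_sumr; apply: eq_bigr => l _.
rewrite (lowered_form_entry _ _ _ dG) -mulrA; congr (_ * _).
rewrite mulr_suml; apply: eq_bigr => i _; rewrite -mulrA; congr (_ * (_ * _)).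
by rewrite !E.
Qed.

(** Near p, the metric in the chart [phi p] is the pullback of the metric in the chart [phi r] by
    the change of charts; [connection_form_chart] then applies. *)
Lemma conn_chart p r v : cdom (phi r) p ->
  conn g p v *m chg p r p =
    'D_v (jacobian (local_map (@idfun P) p r)) (phi p p)
    + chg p r p *m connection_form (form_chart r) (phi r p) (v *m chg p r p).
Proof.
move=> rp; pose U := local_dom (@idfun P) setT p r.
have oU : open U by apply: open_local_dom; [move=> z; exact: cvg_id|exact: openT].
have Up : U (phi p p) by exists p => //; split=> //; split=> //; exact: phi_dom.
have -> : conn g p v =
    connection_form (pullback_form (local_map (@idfun P) p r) (form_chart r)) (phi p p) v.
  apply: etrans (conn_connection_form p v) _; apply: connection_form_near_eq.
  apply: filterS (open_nbhs_nbhs (conj oU Up)) => _ [z [[pz _] rz] <-].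
  apply: etrans (form_chartE pz) _; apply: etrans (form_coord_chg pz rz) _.
  have E := local_mapE (@idfun P) r pz.
  by rewrite /pullback_form E (form_chartE rz).
have E : phi r p = local_map (@idfun P) p r (phi p p) := esym (local_mapE idfun r (phi_dom p)).
rewrite E.
apply: (@connection_form_chart _ _ U (phi r @` cdom (phi r))) => //.
- exact: cimg_open.
- by move=> _ [z [[pz _] rz] <-]; rewrite local_mapE //; exists z.
- exact: smooth_local_map (smooth_map_id _).
- exact: metric_smooth.
- by move=> y _; exact: form_chart_sym.
- exact: form_chart_unit.
- exact: (chg_unit (phi_dom p) rp).
Qed.

End Metric.

Section Along.
Variables (m n : nat) (M : manifold R m) (P : manifold R n) (f : M -> P).
Variable g : P -> 'M[R]_n.
Hypotheses (hg : riemannian g) (sf : smooth_map f).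

Lemma smooth_along_chart O N q r :
  smooth_along f O N -> smooth_on (local_dom f O q r) (coord_along f r N \o cinv (phi q)).
Proof. by move=> sN; exact: (sN q r). Qed.

Lemma local_domP O q r x : O x -> cdom (phi q) x -> cdom (phi r) (f x) ->
  local_dom f O q r (phi q x).
Proof. by exists x. Qed.

Lemma differentiable_along O N q r x : smooth_along f O N -> O x ->
  cdom (phi q) x -> cdom (phi r) (f x) ->
  differentiable (coord_along f r N \o cinv (phi q)) (phi q x).
Proof.
by move=> sN Ox qx rx; apply: smooth_on_diff (smooth_along_chart q r sN) _; exact: local_domP.
Qed.

Lemma derive_chart (a b : nat) (K : M -> 'M[R]_(a, b)) q q' x u :
  cdom (phi q) x -> cdom (phi q') x ->
  differentiable (K \o cinv (phi q)) (phi q x) ->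
  'D_u (K \o cinv (phi q')) (phi q' x) =
  'D_(u *m chg q' q x) (K \o cinv (phi q)) (phi q x).
Proof.
move=> qx qx' dK.
have dT := differentiable_local_map (smooth_map_id M) qx' (r := q) qx.
rewrite -[in RHS](local_mapE (@idfun M) q qx').
rewrite [u *m _](_ : _ = 'D_u (local_map (@idfun M) q' q) (phi q' x)); last first.
  by rewrite deriveEjacobian.
rewrite -derive_comp //; last by rewrite local_mapE.
apply: near_eq_derive.
have := chart_near qx' (chart_near_dom qx).
by apply: filterS => y qy; rewrite /local_map /= cmapK.
Qed.

(** The left side is defined with the charts [phi x] and [phi (f x)], which change with x; on the
    right the charts q and r are fixed, so the right side can be differentiated in x. *)
Lemma cov_along_chart O N X q r x : open O -> O x -> smooth_along f O N ->
  cdom (phi q) x -> cdom (phi r) (f x) ->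
  cov_along f g X N x *m chg (f x) r (f x) =
   'D_(X x *m chg x q x) (coord_along f r N \o cinv (phi q)) (phi q x)
   + coord_along f r N x *m
     connection_form (form_chart g r) (phi r (f x)) (X x *m chg x q x *m dlocal f q r x).
Proof.
move=> oO Ox sN qx rx; set p := f x; have pp : cdom (phi p) p := phi_dom p.
have xx : cdom (phi x) x := phi_dom x.
have dNr := differentiable_along sN Ox qx rx.
have dNp := differentiable_along sN Ox xx pp.
have df := differentiable_local_map sf xx pp.
set T := local_map (@idfun P) p r.
have sT : smooth_on (local_dom (@idfun P) setT p r) T by exact: smooth_local_map (smooth_map_id _).
have oT : open (local_dom (@idfun P) setT p r)
  by apply: open_local_dom; [move=> z; exact: cvg_id|exact: openT].
have dT : differentiable (jacobian T) (phi p p).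
  by apply: smooth_on_diff (smooth_on_jacobian oT sT) _; exists p.
rewrite -derive_chart //.
(* In the chart r, N is its expression in the chart p times the Jacobian of the transition map T.
   The derivative of that Jacobian matches the second-derivative term of [conn_chart]. *)
have -> : 'D_(X x) (coord_along f r N \o cinv (phi x)) (phi x x) =
   'D_(X x) (fun y => (coord_along f p N \o cinv (phi x)) y
                       *m jacobian T (local_map f x p y)) (phi x x).
  apply: near_eq_derive.
  have H : \near x, cdom (phi r) (f x) /\ cdom (phi p) (f x).
    apply: filterI; [exact: (sf.1 x) (chart_near_dom rx)|].
    exact: (sf.1 x) (chart_near_dom pp).
  move/(chart_near xx): H; apply: filterS2 (chart_nearK xx) => y yK [ry py].
  rewrite [LHS]/= (coord_along_chg N py ry) /=; congr (_ *m _).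
rewrite derive_mulmx //; last first.
  by apply: (differentiable_comp df); rewrite local_mapE.
rewrite (@derive_comp _ _ _ _ (local_map f x p) (jacobian T)) //; last by rewrite local_mapE.
have -> : 'D_(X x) (local_map f x p) (phi x x) = X x *m dmap f x := deriveEjacobian _ df.
have -> : (coord_along f p N \o cinv (phi x)) (phi x x) = N x.
  by rewrite /= cmapK // coord_along_self.
rewrite (local_mapE f p xx) -[jacobian T (phi p p)]/(chg p r p).
have <- : X x *m dmap f x *m chg p r p = X x *m chg x q x *m dlocal f q r x.
  rewrite -!mulmxA; congr (_ *m _).
  have E1 := chg_dlocal_chg sf xx xx pp rx; have E2 := chg_dlocal_chg sf xx qx rx rx.
  rewrite (chg_id xx) mul1mx in E1; rewrite (chg_id rx) mulmx1 in E2.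
  by rewrite E2 -E1.
rewrite /cov_along mulmxDl -(mulmxA (N x)) (conn_chart hg _ rx) -/p -/T.
rewrite [coord_along f r N x]/coord_along -/p.
move: ('D_(X x) _ _) (connection_form _ _ _) ('D_(X x *m dmap f x) _ _) => A B C.
by rewrite mulmxDr mulmxA addrA.
Qed.

End Along.

End Connections.

(** * Smoothness of derived fields *)

Section SmoothFields.
Variable R : realType.

Lemma connection_form_coord n (G : 'rV[R]_n -> 'M[R]_n) y u : differentiable G y ->
  connection_form G y u = \sum_i u 0 i *: connection_form G y (delta_mx 0 i).
Proof.
move=> dG; rewrite /connection_form -[RHS]/(\sum_i u 0 i *: (_ *m _)).
under eq_bigr do rewrite scalemxAl.
rewrite -mulmx_suml; congr (_ *m _); apply/matrixP => j l.
rewrite summxE (lowered_form_entry _ _ _ dG) mulr_sumr; apply: eq_bigr => i _.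
rewrite mxE (lowered_form_entry _ _ _ dG) mulrCA; congr (_ * (_ * _)).
rewrite (bigD1 i) //= big1 ?addr0 => [|k /negPf ki]; last first.
  by rewrite mxE ki andbF mul0r.
by rewrite mxE !eqxx mul1r.
Qed.

(** The direction [X y] depends on the source while the form lives on the target; expanding [X y]
    over the basis leaves constant directions, to which the composition rule applies. *)
Lemma smooth_on_connection_comp m n (U : set 'rV[R]_m) (U' : set 'rV[R]_n) G
    (F X : 'rV[R]_m -> 'rV[R]_n) :
  open U -> open U' -> (forall y, U y -> U' (F y)) -> smooth_on U F ->
  smooth_on U X -> smooth_on U' G -> (forall y, U' y -> G y \in unitmx) ->
  smooth_on U (fun y => connection_form G (F y) (X y)).
Proof.
move=> oU oU' FU sF sX sG uG.
apply: (@smooth_on_eq _ _ _ _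
  (fun y => \sum_i X y 0 i *: connection_form G (F y) (delta_mx 0 i)) _ oU).
  move=> y Uy; rewrite [RHS]connection_form_coord //.
  by apply: smooth_on_diff sG _; exact: FU.
apply: smooth_on_sum => // i; apply: smooth_onZ => //.
  by move/(smooth_on_mxP oU): sX; exact.
apply: (smooth_on_comp (g := fun y => connection_form G y (delta_mx 0 i)) oU oU' FU sF).
by apply: smooth_on_connection => //; exact: smooth_on_cst.
Qed.

Section Along.
Variables (m n : nat) (M : manifold R m) (P : manifold R n) (f : M -> P).
Hypothesis sf : smooth_map f.

Lemma smooth_along_sub (O O' : set M) N : O' `<=` O -> smooth_along f O N ->
  smooth_along f O' N.
Proof.
move=> OO' sN q r; apply: smooth_on_sub (sN q r) => _ [x [[qx Ox] rx] <-].
by exists x => //; split=> //; split=> //; exact: OO'.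
Qed.

(** One target chart around each point is enough: the others follow by multiplying with the Jacobian
    of the transition map. *)
Lemma smooth_along_intro O N : open O ->
  (forall x q, O x -> cdom (phi q) x -> exists r (U : set 'rV[R]_m),
    [/\ cdom (phi r) (f x), open U, U (phi q x) &
        smooth_on U (coord_along f r N \o cinv (phi q))]) ->
  smooth_along f O N.
Proof.
move=> oO H q r'; apply: smooth_on_local => _ [x [[qx Ox] rx'] <-].
have [r [U [rx oU Ux sN]]] := H x q Ox qx.
pose V := U `&` (local_dom f O q r `&` local_dom f O q r').
have oV : open V.
  by apply: openI => //; apply: openI; apply: open_local_dom => //; exact: sf.1.
exists V; first by split=> //; split; exists x.
pose T := local_map (@idfun P) r r'.
have oT : open (local_dom (@idfun P) setT r r').
  by apply: open_local_dom; [move=> z; exact: cvg_id|exact: openT].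
apply: (@smooth_on_eq _ _ _ _ (fun y => (coord_along f r N \o cinv (phi q)) y
     *m jacobian T (local_map f q r y)) _ oV).
  (* A point of V comes from z through the first local domain and from z' through the second;
     injectivity of the chart q identifies them. *)
  move=> _ [_ [[z [[qz _] rz] <-] [z' [[qz' _] rz'] zz']]].
  have E : z' = z by rewrite -(cmapK qz') zz' cmapK.
  rewrite E in rz'; rewrite [RHS]/= (cmapK qz) (coord_along_chg N rz rz').
  by rewrite (local_mapE f r qz) /= (cmapK qz).
apply: smooth_on_mulmx; [exact: oV|by apply: smooth_on_sub sN => y []|].
apply: (smooth_on_comp oV oT).
- move=> _ [_ [[z [[qz _] rz] <-] [z' [[qz' _] rz'] zz']]].
  have E : z' = z by rewrite -(cmapK qz') zz' cmapK.
  by rewrite E in rz'; rewrite (local_mapE f r qz); exists (f z).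
- by apply: smooth_on_sub (smooth_local_map O q r sf) => y [_ []].
- exact: (smooth_on_jacobian oT (smooth_local_map _ _ _ (smooth_map_id _))).
Qed.

Lemma smooth_alongD O N N' : open O -> smooth_along f O N -> smooth_along f O N' ->
  smooth_along f O (fun x => N x + N' x).
Proof.
move=> oO sN sN' q r; have oU : open (local_dom f O q r).
  by apply: open_local_dom => //; exact: sf.1.
apply: (smooth_on_eq oU _ (smooth_onD oU (sN q r) (sN' q r))) => y _.
by rewrite /= /coord_along mulmxDl.
Qed.

Lemma smooth_alongN O N : open O -> smooth_along f O N ->
  smooth_along f O (fun x => - N x).
Proof.
move=> oO sN q r; have oU : open (local_dom f O q r).
  by apply: open_local_dom => //; exact: sf.1.
apply: (smooth_on_eq oU _ (smooth_onN oU (sN q r))) => y _.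
by rewrite /= /coord_along mulNmx.
Qed.

Lemma smooth_along_id_dom O (X : M -> 'rV[R]_m) q r : smooth_along (@idfun M) O X ->
  smooth_on (local_dom f O q r) (coord_along (@idfun M) q X \o cinv (phi q)).
Proof.
move=> sX; apply: smooth_on_sub (sX q q) => _ [x [[qx Ox] rx] <-].
by exists x.
Qed.

Lemma coord_along_push (Y : M -> 'rV[R]_m) q r x :
  cdom (phi q) x -> cdom (phi r) (f x) ->
  coord_along f r (push f Y) x = coord_along (@idfun M) q Y x *m dlocal f q r x.
Proof.
move=> qx rx; rewrite /coord_along /push (dlocalE sf qx rx) /= !mulmxA.
rewrite -(mulmxA (Y x) (chg x q x)) (chg_comp (phi_dom x) qx (phi_dom x)).
by rewrite (chg_id (phi_dom x)) mulmx1.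
Qed.

Lemma smooth_push O (Y : M -> 'rV[R]_m) : open O -> smooth_along (@idfun M) O Y ->
  smooth_along f O (push f Y).
Proof.
move=> oO sY q r; have oU : open (local_dom f O q r).
  by apply: open_local_dom => //; exact: sf.1.
have sJ := smooth_on_jacobian oU (smooth_local_map O q r sf).
have sYq := smooth_along_id_dom q r sY.
apply: (smooth_on_eq oU _ (smooth_on_mulmx oU sYq sJ)).
move=> _ [x [[qx Ox] rx] <-]; rewrite /= cmapK //.
by rewrite (coord_along_push Y qx rx).
Qed.

Variable g : P -> 'M[R]_n.
Hypothesis hg : riemannian g.

Lemma smooth_cov_along O N X : open O -> smooth_along (@idfun M) O X ->
  smooth_along f O N -> smooth_along f O (cov_along f g X N).
Proof.
move=> oO sX sN q r; have oU : open (local_dom f O q r).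
  by apply: open_local_dom => //; exact: sf.1.
have sF := smooth_local_map O q r sf.
have sJ := smooth_on_jacobian oU sF.
have sXq := smooth_along_id_dom q r sX.
(* [K] is the right side of [cov_along_chart] as a function of the coordinate y. *)
pose K y := 'D_((coord_along (@idfun M) q X \o cinv (phi q)) y)
    (coord_along f r N \o cinv (phi q)) y
  + (coord_along f r N \o cinv (phi q)) y *m
    connection_form (form_chart g r) (local_map f q r y)
      ((coord_along (@idfun M) q X \o cinv (phi q)) y *m jacobian (local_map f q r) y).
apply: (@smooth_on_eq _ _ _ _ K _ oU).
  move=> _ [x [[qx Ox] rx] <-]; rewrite /K (local_mapE f r qx) /= (cmapK qx).
  by rewrite [RHS](cov_along_chart hg sf X oO Ox sN qx rx).
apply: (smooth_onD oU (smooth_on_directional oU sXq (sN q r))).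
apply: (smooth_on_mulmx oU (sN q r)).
have FU y : local_dom f O q r y -> (phi r @` cdom (phi r)) (local_map f q r y).
  by move=> [x [[qx Ox] rx] <-]; rewrite local_mapE //; exists (f x).
exact: (smooth_on_connection_comp (G := form_chart g r) oU (@cimg_open _ _ _ (phi r))
  FU sF (smooth_on_mulmx oU sXq sJ)
  (metric_smooth hg r) (fun y => @form_chart_unit _ _ _ _ hg r y)).
Qed.

Lemma form_coord_induced q r x : cdom (phi q) x -> cdom (phi r) (f x) ->
  form_coord q (induced_metric f g) x =
  dlocal f q r x *m form_coord r g (f x) *m (dlocal f q r x)^T.
Proof.
move=> qx rx; have pp := phi_dom (f x).
have CB := etrans (chg_comp pp rx pp) (chg_id pp).
rewrite (dlocalE sf qx rx) /form_coord /induced_metric.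
move: (chg q x x) (dmap f x) (chg (f x) r (f x)) (chg r (f x) (f x)) CB => A D C B CB.
rewrite !trmx_mul !mulmxA -(mulmxA _ C B) CB mulmx1.
by rewrite -(mulmxA _ B^T C^T) -trmx_mul CB trmx1 mulmx1.
Qed.

Hypothesis rf : forall x, row_free (dmap f x).

Lemma induced_riemannian : riemannian (induced_metric f g).
Proof.
split.
- by move=> x; rewrite /induced_metric !trmx_mul trmxK (Defs.metric_sym hg) mulmxA.
- move=> x u u0; have := metric_pos hg (f x) (_ : u *m dmap f x != 0).
  rewrite /ip /induced_metric trmx_mul !mulmxA; apply.
  by rewrite mulmx_free_eq0.
- move=> q; apply: smooth_on_local => _ [x qx <-].
  have oU : open (local_dom f setT q (f x)).
    by apply: open_local_dom; [exact: sf.1|exact: openT].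
  exists (local_dom f setT q (f x)).
    by exists x => //; split=> //; exact: phi_dom.
  apply: (@smooth_on_eq _ _ _ _ (pullback_form (local_map f q (f x)) (form_chart g (f x))) _ oU).
    move=> _ [z [[qz _] rz] <-]; rewrite /= (cmapK qz) (form_coord_induced qz rz).
    rewrite /pullback_form (local_mapE f _ qz) form_chartE //.
  apply: (smooth_on_pullback oU (@cimg_open _ _ _ (phi (f x))) _
    (smooth_local_map _ _ _ sf) (metric_smooth hg (f x))).
  by move=> _ [z [[qz _] rz] <-]; rewrite local_mapE //; exists (f z).
Qed.

End Along.

Lemma smooth_tangent_part m n (M : manifold R m) (P : manifold R n) (f : M -> P)
    (g : P -> 'M[R]_n) O N :
  smooth_map f -> riemannian g -> (forall x, row_free (dmap f x)) ->
  open O -> smooth_along f O N ->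
  smooth_along (@idfun M) O (fun x => tangent_part f g x (N x)).
Proof.
move=> sf hg rf oO sN; have hh := induced_riemannian sf hg rf.
apply: (smooth_along_intro (smooth_map_id M) oO) => x q Ox qx.
pose r := f x; have rx : cdom (phi r) (f x) := phi_dom (f x).
have oU : open (local_dom f O q r) by apply: open_local_dom => //; exact: sf.1.
have sF := smooth_local_map O q r sf; have sJ := smooth_on_jacobian oU sF.
exists q, (local_dom f O q r); split; [exact: qx|exact: oU|by exists x|].
(* The formula of [tangent_part] with every factor read in the fixed charts q and r; the changes of
   charts cancel in pairs. *)
pose K y := (coord_along f r N \o cinv (phi q)) y *m form_chart g r (local_map f q r y)
  *m (jacobian (local_map f q r) y)^T *m invmx (form_chart (induced_metric f g) q y).
apply: (@smooth_on_eq _ _ _ _ K _ oU).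
  move=> _ [z [[qz Oz] rz] <-].
  rewrite /K (local_mapE f r qz) (form_chartE g rz)
    (form_chartE (induced_metric f g) qz) /= (cmapK qz).
  rewrite -[jacobian _ _]/(dlocal f q r z) /coord_along (dlocalE sf qz rz).
  have uI : induced_metric f g z \in unitmx := metric_unit hh z.
  have pp := phi_dom (f z); have zz := phi_dom z.
  have CB := etrans (chg_comp pp rz pp) (chg_id pp).
  have AA := etrans (chg_comp zz qz zz) (chg_id zz).
  have uH := form_coord_unit hh qz.
  apply: (canLR (mulmxK uH)); rewrite /form_coord /tangent_part.
  move: (induced_metric f g z) (chg q z z) (chg z q z) (dmap f z)
    (chg (f z) r (f z)) (chg r (f z) (f z)) uI CB AA => I A A' D C B uI CB AA.
  rewrite !trmx_mul !mulmxA -(mulmxA _ C B) CB mulmx1.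
  rewrite -(mulmxA _ B^T C^T) -trmx_mul CB trmx1 mulmx1.
  by rewrite -(mulmxA _ A' A) AA mulmx1 (mulmxKV uI).
have FU y : local_dom f O q r y -> (phi r @` cdom (phi r)) (local_map f q r y).
  by move=> [z [[qz Oz] rz] <-]; rewrite local_mapE //; exists (f z).
have QU : local_dom f O q r `<=` phi q @` cdom (phi q).
  by move=> _ [z [[qz _] _] <-]; exists z.
apply: smooth_on_mulmx => //.
  apply: (smooth_on_mulmx oU _ (smooth_on_trmx oU sJ)).
  apply: (smooth_on_mulmx oU (sN q r)).
  exact: (smooth_on_comp oU (@cimg_open _ _ _ (phi r)) FU sF (metric_smooth hg r)).
apply: smooth_on_invmx => //.
  exact: smooth_on_sub QU (metric_smooth hh q).
by move=> y /QU; exact: form_chart_unit.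
Qed.

End SmoothFields.

(** * The second fundamental form *)

Section InnerProduct.
Variables (R : realType) (n : nat) (P : manifold R n) (g : P -> 'M[R]_n).
Variable p : P.

Lemma ipDl u v w : ip g p (u + v) w = ip g p u w + ip g p v w.
Proof. by rewrite /ip !mulmxDl mxE. Qed.

Lemma ipNl u w : ip g p (- u) w = - ip g p u w.
Proof. by rewrite /ip !mulNmx mxE. Qed.

Lemma ipDr u v w : ip g p w (u + v) = ip g p w u + ip g p w v.
Proof. by rewrite /ip linearD mulmxDr mxE. Qed.

Lemma ipNr u w : ip g p w (- u) = - ip g p w u.
Proof. by rewrite /ip linearN mulmxN mxE. Qed.

Lemma ipC u v : riemannian g -> ip g p u v = ip g p v u.
Proof.
move=> hg; rewrite /ip -[u *m _ *m _]trmx11 !trmx_mul trmxK (Defs.metric_sym hg).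
by rewrite mulmxA.
Qed.

Lemma ip_mxl k (u : 'rV[R]_k) (A : 'M[R]_(k, n)) v :
  A *m g p *m v^T = 0 -> ip g p (u *m A) v = 0.
Proof. by move=> H; rewrite /ip -2!mulmxA (mulmxA A) H mulmx0 mxE. Qed.

End InnerProduct.

Section SecondFundamentalForm.
Variables (R : realType) (m n : nat) (M : manifold R m) (P : manifold R n).
Variables (f : M -> P) (g : P -> 'M[R]_n).
Hypotheses (hg : riemannian g) (sf : smooth_map f).
Hypothesis rf : forall x, row_free (dmap f x).

Let h := induced_metric f g.
Let hh : riemannian h := induced_riemannian sf hg rf.

(* [v *m sff x u] is the value at x of B(u, v). *)
Definition sff (x : M) (u : 'rV[R]_m) : 'M[R]_(m, n) :=
  'D_u (jacobian (local_map f x (f x))) (phi x x)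
  + dmap f x *m conn g (f x) (u *m dmap f x)
  - conn (induced_metric f g) x u *m dmap f x.

Let dom x := local_dom f setT x (f x).

Let open_dom x : open (dom x).
Proof. by apply: open_local_dom; [exact: sf.1|exact: openT]. Qed.

Let dom_in x : dom x (phi x x).
Proof. by exists x => //; split; [split=> //; exact: phi_dom|exact: phi_dom]. Qed.

Let smooth_dom x : smooth_on (dom x) (local_map f x (f x)).
Proof. exact: smooth_local_map. Qed.

Let diff_jacobian x : differentiable (jacobian (local_map f x (f x))) (phi x x).
Proof. exact: smooth_on_diff (smooth_on_jacobian (@open_dom x) (@smooth_dom x)) (dom_in x). Qed.

(** Each of the three terms is symmetric: the first by Schwarz, the other two because both
    connections are torsion-free. *)
Lemma sff_sym x u v : v *m sff x u = u *m sff x v.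
Proof.
rewrite /sff !(mulmxDr, mulmxN) !mulmxA.
rewrite (derive_jacobianC (@open_dom x) (@smooth_dom x) u v (dom_in x)).
rewrite (conn_torsion_free (f x) _ _ hg) (conn_torsion_free x _ _ hh) //.
Qed.

(** The Gauss formula [connection_form_pullback] for f read in the charts [phi x] and [phi (f x)],
    where both connection forms are values of [conn]. *)
Lemma sff_normal x u : sff x u *m g (f x) *m (dmap f x)^T = 0.
Proof.
pose p := f x; have pp : cdom (phi p) p := phi_dom p.
have xx : cdom (phi x) x := phi_dom x.
have pE : \forall y \near phi x x, form_chart h x y =
    pullback_form (local_map f x p) (form_chart g p) y.
  apply: filterS (open_nbhs_nbhs (conj (@open_dom x) (dom_in x))).
  move=> _ [z [[xz _] pz] <-]; apply: etrans (form_chartE _ xz) _.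
  apply: etrans (form_coord_induced sf g xz pz) _.
  by rewrite /pullback_form (local_mapE f p xz) (form_chartE g pz).
have FU y : dom x y -> (phi p @` cdom (phi p)) (local_map f x p y).
  by move=> [z [[xz _] pz] <-]; rewrite local_mapE //; exists (f z).
have pu : pullback_form (local_map f x p) (form_chart g p) (phi x x) \in unitmx.
  by rewrite -(nbhs_singleton pE) (form_chartE h xx); exact: form_coord_unit.
have := connection_form_pullback (@open_dom x) (@cimg_open _ _ _ (phi p)) FU
  (@smooth_dom x) (metric_smooth hg p) (fun y _ => form_chart_sym hg p y)
  (fun y => @form_chart_unit _ _ _ _ hg p y) u (dom_in x) pu.
rewrite -(connection_form_near_eq _ pE) (local_mapE f p xx).
rewrite -(conn_connection_form hg) -(conn_connection_form hh)
  -[form_coord p g \o _]/(form_chart g p).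
by rewrite (form_chartE g pp) form_coord_self.
Qed.

(** Tensoriality of B: the derivative of Y occurs once in the derivative of [push f Y] and once in
    [nabla], and the two cancel. *)
Lemma second_formE O X Y x : smooth_along (@idfun M) O Y -> O x ->
  second_form f g X Y x = Y x *m sff x (X x).
Proof.
move=> sY Ox; have xx : cdom (phi x) x := phi_dom x.
have pp : cdom (phi (f x)) (f x) := phi_dom (f x).
have dY := differentiable_along sY Ox xx xx.
rewrite /second_form /cov_along /nabla /cov_along.
have -> : 'D_(X x) (coord_along f (f x) (push f Y) \o cinv (phi x)) (phi x x) =
    'D_(X x) (fun y => (coord_along (@idfun M) x Y \o cinv (phi x)) y *m
                       jacobian (local_map f x (f x)) y) (phi x x).
  apply: near_eq_derive.
  apply: filterS (open_nbhs_nbhs (conj (@open_dom x) (dom_in x))).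
  move=> _ [z [[xz _] pz] <-]; rewrite /= (cmapK xz).
  by rewrite (coord_along_push sf Y xz pz).
rewrite (derive_mulmx _ dY (@diff_jacobian x)) /push mulmxDl.
have -> : (coord_along (@idfun M) x Y \o cinv (phi x)) (phi x x) = Y x.
  by rewrite /= (cmapK xx); exact: (coord_along_self (@idfun M) Y x).
have -> : dmap (@idfun M) x = 1%:M := chg_id xx.
rewrite mulmx1 -[jacobian (local_map f x (f x)) (phi x x)]/(dmap f x) /sff.
move: ('D_(X x) _ _) ('D_(X x) _ _) => B A.
by rewrite mulmxBr mulmxDr !mulmxA opprD addrA -(addrA (A *m _)) [A *m _ + _]addrC addrK.
Qed.

Lemma second_form_normal O X Y x : smooth_along (@idfun M) O Y -> O x ->
  normal f g x (second_form f g X Y x).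
Proof.
move=> sY Ox u; rewrite (second_formE _ sY Ox) ip_mxl //.
by rewrite trmx_mul mulmxA sff_normal mul0mx.
Qed.

(** Compatibility with the metric, for fields that stay orthogonal: the left side is the derivative
    of the constant 0. *)
Lemma cov_along_metric0 O N N' X x : open O -> O x ->
  smooth_along f O N -> smooth_along f O N' ->
  (forall z, O z -> ip g (f z) (N z) (N' z) = 0) ->
  ip g (f x) (cov_along f g X N x) (N' x) + ip g (f x) (N x) (cov_along f g X N' x) = 0.
Proof.
move=> oO Ox sN sN' N0; pose p := f x; have pp : cdom (phi p) p := phi_dom p.
have xx : cdom (phi x) x := phi_dom x.
pose a := coord_along f p N \o cinv (phi x); pose b := coord_along f p N' \o cinv (phi x).
have da : differentiable a (phi x x) := differentiable_along sN Ox xx pp.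
have db : differentiable b (phi x x) := differentiable_along sN' Ox xx pp.
have dF := differentiable_local_map sf xx pp.
have dG : differentiable (form_chart g p) (phi p p).
  by apply: smooth_on_diff (metric_smooth hg p) _; exists p.
pose G := form_chart g p \o local_map f x p.
have dGF : differentiable G (phi x x).
  by apply: differentiable_comp => //; rewrite local_mapE.
have Ux : local_dom f O x p (phi x x) by exists x.
have oU : open (local_dom f O x p) by apply: open_local_dom => //; exact: sf.1.
have E0 : 'D_(X x) (fun y => a y *m G y *m (b y)^T) (phi x x) = 0.
  rewrite -(derive_cst (0 : 'M[R]_1) (phi x x) (X x)); apply: near_eq_derive.
  apply: filterS (open_nbhs_nbhs (conj oU Ux)) => _ [z [[xz Oz] pz] <-].
  rewrite /a /b /G /= (local_mapE f p xz) (form_chartE g pz) (cmapK xz) /cst.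
  apply/matrixP => i j; rewrite !ord1 [RHS]mxE -[RHS](N0 z Oz) /ip /coord_along /form_coord.
  have CB := etrans (chg_comp (phi_dom (f z)) pz (phi_dom (f z))) (chg_id (phi_dom (f z))).
  move: (chg (f z) p (f z)) (chg p (f z) (f z)) CB => C B CB.
  rewrite !trmx_mul !mulmxA -(mulmxA _ C B) CB mulmx1.
  by rewrite -(mulmxA _ B^T C^T) -trmx_mul CB trmx1 mulmx1.
move: E0; rewrite derive_mulmx; [|exact: differentiable_mulmx|exact: differentiable_trmx].
rewrite derive_mulmx // derive_trmx // /G derive_comp //; last by rewrite local_mapE.
rewrite (local_mapE f p xx) (deriveEjacobian (X x) dF) -[jacobian _ _]/(dmap f x) -/p.
(* The derivative of the metric along f splits into two connection terms, one completing each
   covariant derivative. *)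
rewrite (connection_form_metric (G := form_chart g p)
  (@cimg_open _ _ _ (phi p)) (metric_smooth hg p)
  (fun y _ => form_chart_sym hg p y) (fun y => @form_chart_unit _ _ _ _ hg p y)); last by exists p.
have Gp : form_chart g p (phi p p) = g p := etrans (form_chartE g pp) (form_coord_self g p).
have Gx : (form_chart g p \o local_map f x p) (phi x x) = g p.
  by rewrite -[LHS]/(form_chart g p (local_map f x p (phi x x))) (local_mapE f p xx).
rewrite -(conn_connection_form hg) Gx Gp.
have -> : a (phi x x) = N x by rewrite /a /= (cmapK xx) coord_along_self.
have -> : b (phi x x) = N' x by rewrite /b /= (cmapK xx) coord_along_self.
move=> /matrixP/(_ 0 0); rewrite [RHS]mxE => <-.
rewrite /ip /cov_along -/p -/a -/b.
move: ('D_(X x) a _) ('D_(X x) b _) (conn _ _ _) (g p) => A B C G0.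
rewrite !(mulmxDl, mulmxDr) linearD /= trmx_mul !mulmxA mulmxDr !mulmxA.
have addE (U V : 'M[R]_1) : U 0 0 + V 0 0 = (U + V) 0 0 by rewrite mxE.
by rewrite addE; congr (fun_of_matrix _ 0 0); rewrite [X in _ + X]addrC !addrA.
Qed.

End SecondFundamentalForm.

(** * The shape operator *)

Section ShapeOperator.
Variables (R : realType) (m n : nat) (M : manifold R m) (P : manifold R n).
Variables (f : M -> P) (g : P -> 'M[R]_n).
Hypotheses (hg : riemannian g) (sf : smooth_map f).
Hypothesis rf : forall x, row_free (dmap f x).

Let h := induced_metric f g.
Let hh : riemannian h := induced_riemannian sf hg rf.

(** The field with constant components [v] in the chart [phi x]: a local extension of v, sufficient
    for identities at the point x. *)
Lemma smooth_chart_field x (v : 'rV[R]_m) :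
  smooth_along (@idfun M) (cdom (phi x)) (fun z => v *m chg x z z).
Proof.
apply: (smooth_along_intro (smooth_map_id M) (@cdom_open _ _ _ (phi x))) => z q xz qz.
have oU : open (local_dom (@idfun M) setT x q).
  by apply: open_local_dom; [move=> ?; exact: cvg_id|exact: openT].
pose U := phi q @` (cdom (phi q) `&` cdom (phi x)).
have oUq : open U by apply: open_chart_image; exact: cdom_open.
exists x, U; split; [exact: xz|exact: oUq|by exists z|].
apply: (smooth_on_eq oUq _ (smooth_on_cst U v)) => _ [y [qy xy] <-].
rewrite /= (cmapK qy) /coord_along /= -mulmxA.
by rewrite (chg_comp xy (phi_dom y) xy) (chg_id xy) mulmx1.
Qed.

Lemma ip_tangent_part x w (v : 'rV[R]_m) :
  ip h x (tangent_part f g x w) v = ip g (f x) w (v *m dmap f x).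
Proof.
have uI : induced_metric f g x \in unitmx := metric_unit hh x.
by rewrite /ip /tangent_part /h (mulmxKV uI) trmx_mul !mulmxA.
Qed.

Lemma ip_induced x (u v : 'rV[R]_m) :
  ip h x u v = ip g (f x) (u *m dmap f x) (v *m dmap f x).
Proof. by rewrite /ip /h /induced_metric trmx_mul !mulmxA. Qed.

Lemma ip_cov_along_push X Y x w (O : set M) :
  smooth_along (@idfun M) O Y -> O x -> normal f g x w ->
  ip g (f x) w (cov_along f g X (push f Y) x) =
  ip g (f x) w (Y x *m sff f g x (X x)).
Proof.
move=> sY Ox nw; rewrite -(second_formE g sf X sY Ox) /second_form.
by rewrite ipDr ipNr /push nw subr0.
Qed.

(** Weingarten equation, from differentiating gbar(N, Y) = 0 where Y is the chart-constant extension
    of v. *)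
Lemma shape_opE O N X x v : open O -> O x -> smooth_along f O N ->
  (forall z, O z -> normal f g z (N z)) ->
  ip h x (shape_op f g N X x) v = ip g (f x) (N x) (v *m sff f g x (X x)).
Proof.
move=> oO Ox sN nN; pose Y z := v *m chg x z z; pose O' := O `&` cdom (phi x).
have O'x : O' x by split=> //; exact: phi_dom.
have oO' : open O' by apply: openI => //; exact: cdom_open.
have sY : smooth_along (@idfun M) O' Y.
  by apply: smooth_along_sub (smooth_chart_field x v) => z [].
have sN' : smooth_along f O' N by apply: smooth_along_sub sN => z [].
have Yx : Y x = v by rewrite /Y chg_id ?mulmx1 //; exact: phi_dom.
have N0 z : O' z -> ip g (f z) (N z) (push f Y z) = 0 by move=> [Oz _]; exact: nN.
have := cov_along_metric0 hg sf X oO' O'x sN' (smooth_push sf oO' sY) N0.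
rewrite (ip_cov_along_push X sY O'x (nN x Ox)) Yx /shape_op ipNl ip_tangent_part.
by rewrite /push Yx => /eqP; rewrite addr_eq0 => /eqP ->; rewrite opprK.
Qed.

Lemma end_coordK (A : P -> 'M[R]_n) (N : M -> 'rV[R]_n) r x : cdom (phi r) (f x) ->
  coord_along f r (fun z => N z *m A (f z)) x = coord_along f r N x *m end_coord r A (f x).
Proof.
move=> rx; have CB := etrans (chg_comp (phi_dom (f x)) rx (phi_dom (f x))) (chg_id (phi_dom (f x))).
rewrite /coord_along /end_coord.
move: (chg (f x) r (f x)) (chg r (f x) (f x)) CB => C B CB.
by rewrite !mulmxA -(mulmxA _ C B) CB mulmx1.
Qed.

Lemma smooth_along_end (O : set M) (O' : set P) A N : open O -> open O' ->
  smooth_end O' A -> smooth_along f O N ->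
  smooth_along f (O `&` f @^-1` O') (fun z => N z *m A (f z)).
Proof.
move=> oO oO' sA sN q r; pose V := O `&` f @^-1` O'.
have oV : open V by apply: openI => //; move/continuousP: (sf.1); apply.
have oU : open (local_dom f V q r) by apply: open_local_dom => //; exact: sf.1.
pose K y := (coord_along f r N \o cinv (phi q)) y
  *m (end_coord r A \o cinv (phi r)) (local_map f q r y).
apply: (@smooth_on_eq _ _ _ _ K _ oU).
  move=> _ [z [[qz Oz] rz] <-].
  by rewrite /K /= (local_mapE f r qz) (cmapK qz) (cmapK rz) end_coordK.
apply: (smooth_on_mulmx oU).
  by apply: smooth_on_sub (sN q r) => _ [z [[qz [Oz _]] rz] <-]; exists z.
have FU y : local_dom f V q r y -> (phi r @` (cdom (phi r) `&` O')) (local_map f q r y).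
  by move=> [z [[qz [_ O'z]] rz] <-]; rewrite local_mapE //; exists (f z).
exact: (smooth_on_comp oU (open_chart_image (c := phi r) oO') FU
  (smooth_local_map _ _ _ sf) (sA r)).
Qed.

Lemma cov_along_end (O : set M) (O' : set P) A N X x : open O -> open O' -> O x -> O' (f x) ->
  smooth_end O' A -> smooth_along f O N ->
  cov_along f g X (fun z => N z *m A (f z)) x =
  cov_along f g X N x *m A (f x) + N x *m cov_end g (X x *m dmap f x) A (f x).
Proof.
move=> oO oO' Ox O'x sA sN; pose p := f x; have pp : cdom (phi p) p := phi_dom p.
have xx : cdom (phi x) x := phi_dom x.
have dN := differentiable_along sN Ox xx pp.
have dF := differentiable_local_map sf xx pp.
have dA : differentiable (end_coord p A \o cinv (phi p)) (phi p p).
  by apply: smooth_on_diff (sA p) _; exists p.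
have Lx := local_mapE f p xx.
have dAF : differentiable (fun y => (end_coord p A \o cinv (phi p)) (local_map f x p y)) (phi x x).
  by apply: (differentiable_comp dF); rewrite Lx.
rewrite /cov_along /cov_end -/p.
have -> : 'D_(X x) (coord_along f p (fun z => N z *m A (f z)) \o cinv (phi x)) (phi x x) =
    'D_(X x) (fun y => (coord_along f p N \o cinv (phi x)) y *m
      (end_coord p A \o cinv (phi p)) (local_map f x p y)) (phi x x).
  apply: near_eq_derive.
  have H := chart_near xx (sf.1 x _ (chart_near_dom pp)).
  apply: filterS2 (chart_nearK xx) H => y yK py.
  by rewrite /= /local_map /= (cmapK py) end_coordK.
rewrite (derive_mulmx _ dN dAF) (derive_comp _ dF) ?Lx // (deriveEjacobian (X x) dF).
rewrite -[jacobian _ _]/(dmap f x).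
have Nx : (coord_along f p N \o cinv (phi x)) (phi x x) = N x.
  by rewrite /= (cmapK xx) coord_along_self.
have Ax : (end_coord p A \o cinv (phi p)) (phi p p) = A p.
  by rewrite /= (cmapK pp) /end_coord (chg_id pp) mul1mx mulmx1.
rewrite Nx Ax; move: ('D_(X x) _ _) ('D_(X x *m dmap f x) _ _) (conn _ _ _) (A p) => a b c d.
(* The connection term of [cov_along] on N, followed by A, cancels the negative term of
   [cov_end]. *)
rewrite !(mulmxDl, mulmxDr, mulmxN) !mulmxA.
by rewrite -!addrA; congr (_ + _); rewrite [RHS]addrCA [X in _ = _ + X]addrC subrK.
Qed.

End ShapeOperator.

(** * Bump functions and extension of vectors *)

Section FlatFunction.
Variable R : realType.

(** The usual exp(-1/t) is the case j = 0; the powers of 1/t make the family stable under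
    derivation. *)
Definition flat (j : nat) (t : R) : R :=
  if 0 < t then t^-1 ^+ j * expR (- t^-1) else 0.

(** The k-th power of s/k <= 1 + s/k <= exp(s/k), whence the constant k^k. *)
Lemma expR_ge_pow k (s : R) : 0 <= s -> s ^+ k <= k%:R ^+ k * expR s.
Proof.
case: k => [|k] s0; first by rewrite !expr0 mul1r -expR0 ler_expR.
have k0 : (0 : R) < k.+1%:R by rewrite ltr0n.
rewrite [expR s](_ : _ = expR (s / k.+1%:R) ^+ k.+1); last first.
  by rewrite -expRM_natl mulrC divfK // gt_eqF.
rewrite -exprMn lerXn2r ?nnegrE ?mulr_ge0 ?expR_ge0 ?(ltW k0) //.
apply: (@le_trans _ _ (k.+1%:R * (1 + s / k.+1%:R))).
  by rewrite mulrDr mulr1 mulrC divfK ?gt_eqF // lerDr ltW.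
by rewrite ler_pM2l // expR_ge1Dx.
Qed.

(** The previous bound at s = 1/t with exponent j + 2; the two spare powers give a quadratic bound,
    so that value and derivative both vanish at 0. *)
Lemma flat_bound j (t : R) : `|flat j t| <= j.+2%:R ^+ j.+2 * t ^+ 2.
Proof.
rewrite /flat; case: ifP => t0; last first.
  by rewrite normr0 mulr_ge0 ?sqr_ge0 // exprn_ge0 // ler0n.
have s0 : 0 < t^-1 by rewrite invr_gt0.
rewrite ger0_norm; last by rewrite mulr_ge0 ?expR_ge0 ?exprn_ge0 ?ltW.
have := ler_wpM2r (expR_ge0 (- t^-1)) (expR_ge_pow j.+2 (ltW s0)).
rewrite -[X in _ <= X]mulrA -expRD subrr expR0 mulr1; set c := j.+2%:R ^+ j.+2 => H.
have t20 : 0 < t ^+ 2 by rewrite exprn_gt0.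
rewrite -(ler_pdivrMr _ _ t20); apply: le_trans H.
by rewrite -exprVn mulrAC -exprD addn2.
Qed.

Lemma flat_is_derive j (t : R) :
  is_derive t 1 (flat j) (flat j.+2 t - j%:R * flat j.+1 t).
Proof.
have [t0|t0|t0] := ltgtP 0 t.
- have dV : is_derive t 1 (fun t : R => t^-1) (- t ^- 2).
    have t1 : t != 0 by rewrite gt_eqF.
    by have := @is_deriveV R id t 1 1 t1 (is_derive_id t 1); rewrite /GRing.scale /= mulr1.
  have dE := @is_derive1_comp R expR (- (fun t : R => t^-1)) t _ _
    (is_derive_expR (- t^-1)) (is_deriveN dV).
  have dM := is_deriveM (is_deriveX j dV) dE.
  apply: (@near_eq_is_derive R R R ((fun t => t^-1) ^+ j * (expR \o - (fun t => t^-1)))).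
    apply: filterS (lt_nbhsr t0) => z z0.
    by rewrite /flat z0 exprfctE.
  rewrite /flat t0 exprfctE in dM *; apply: is_derive_eq dM _.
  rewrite /GRing.scale /= -[(- (fun t : R => t^-1)) t]/(- t^-1) -exprVn.
  move: (expR _) => e; case: j => [|j]; first by rewrite !expr0 mul0r; ring.
  by rewrite -pred_Sn !exprS; ring.
- have F0 i : flat i t = 0 by rewrite /flat ltNge (ltW t0).
  rewrite !F0 mulr0 subr0; apply: (@near_eq_is_derive R R R (cst 0)).
  by apply: filterS (lt_nbhsl t0) => z z0; rewrite /flat ltNge (ltW z0).
(* At 0 the quadratic bound makes the difference quotient at most c |h|. *)
- have F0 i : flat i t = 0 by rewrite /flat -t0 ltxx.
  rewrite !F0 mulr0 subr0 -t0.
  pose c : R := j.+2%:R ^+ j.+2 + 1.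
  have c0 : 0 < c by rewrite ltr_wpDl // exprn_ge0.
  have H : (fun h : R => h^-1 *: ((flat j \o shift 0) (h *: 1) - flat j 0)) @ 0^' --> (0 : R).
    apply/cvgrPdist_lt => e e0; near=> h.
    have h0 : h != 0 by near: h; exact: nbhs_dnbhs_neq.
    rewrite /= t0 F0 -t0 subr0 sub0r normrN addr0 /GRing.scale /= mulr1 normrM normfV.
    rewrite mulrC ltr_pdivrMr ?normr_gt0 //; apply: le_lt_trans (flat_bound _ _) _.
    rewrite -real_normK ?num_real // expr2 mulrA ltr_pM2r ?normr_gt0 //.
    apply: (@le_lt_trans _ _ (c * `|h|)); first by rewrite ler_wpM2r // lerDl.
    rewrite mulrC -ltr_pdivlMr //; near: h; apply: dnbhs0_lt; exact: divr_gt0.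
  by apply: DeriveDef; [apply/cvgP: H|exact: cvg_lim H].
Unshelve. all: by end_near. Qed.

(** The family a * flat i (h) is stable: a derivative only raises the index i, by 1 or 2, and the
    chain rule factor goes into [a]. *)
Lemma smooth_on_flat (V : normedModType R) (U : set V) (h : V -> R) j :
  open U -> smooth_on U h -> smooth_on U (fun y => flat j (h y)).
Proof.
move=> oU sh; pose B (k : V -> R) := exists (a : V -> R) i,
  smooth_on U a /\ k = (fun y => a y * flat i (h y)).
apply: (@smooth_on_gen _ _ _ U B); [exact: oU| |exists (cst 1), j]; last first.
  by split; [exact: smooth_on_cst|apply/funext => y; rewrite mul1r].
have df i t : differentiable (flat i) t.
  by apply/derivable1_diffP; case: (flat_is_derive i t).
have dfh i y : U y -> differentiable (fun y => flat i (h y)) y.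
  by move=> Uy; apply: (differentiable_comp (smooth_on_diff sh Uy)).
move=> _ [a [i [sa ->]]]; split=> [y Uy|v].
  by apply: differentiableM; [exact: smooth_on_diff sa Uy|exact: dfh].
exists 3, (fun k y => match val k with
  | 0 => 'D_v a y * flat i (h y)
  | 1 => (a y * 'D_v h y) * flat i.+2 (h y)
  | _ => (- i%:R * (a y * 'D_v h y)) * flat i.+1 (h y) end).
have sah : smooth_on U (fun y => a y * 'D_v h y).
  by apply: smooth_onM => //; exact: smooth_on_derive.
split=> [[k /= _]|y Uy].
  case: k => [|[|k]].
  - by exists ('D_v a), i; split=> //; exact: smooth_on_derive.
  - by exists (fun y => a y * 'D_v h y), i.+2.
  - exists (fun y => - i%:R * (a y * 'D_v h y)), i.+1; split=> //.
    by apply: smooth_onM => //; exact: smooth_on_cst.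
rewrite [LHS]deriveM; last 2 first.
- exact: smooth_on_derivable sa Uy.
- exact/diff_derivable/dfh.
rewrite (derive_comp _ (smooth_on_diff sh Uy) (df i (h y))).
have -> : 'D_('D_v h y) (flat i) (h y) =
    'D_v h y * (flat i.+2 (h y) - i%:R * flat i.+1 (h y)).
  rewrite deriveE // -[X in 'd _ _ X]mulr1 -[X in 'd _ _ X]/(_ *: (1 : R)) linearZ /=.
  by rewrite -deriveE //; case: (flat_is_derive i (h y)) => _ ->.
rewrite !big_ord_recl big_ord0 /= addr0 /GRing.scale /=.
move: ('D_v h y) ('D_v a y) => u w; ring.
Qed.

End FlatFunction.

Section BumpFunction.
Variables (R : realType) (n : nat) (M : manifold R n).

(** The norm of ['rV[R]_n] is the maximum norm, which is not smooth; the squared Euclidean distance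
    is, and it dominates the squared norm. *)
Definition sqr_dist (y0 y : 'rV[R]_n) : R := ((y - y0) *m (y - y0)^T) 0 0.

Lemma sqr_dist_ge (y0 y : 'rV[R]_n) : `|y - y0| ^+ 2 <= sqr_dist y0 y.
Proof.
rewrite /sqr_dist; move: (y - y0) => d; rewrite mxE.
have -> : \sum_j d 0 j * d^T j 0 = \sum_j (d 0 j) ^+ 2.
  by apply: eq_bigr => j _; rewrite mxE expr2.
rewrite -[`|d|]/(mx_norm d); have [->|/mx_norm_neq0[[i j] /= ->]] := eqVneq (mx_norm d) 0.
  by rewrite expr0n sumr_ge0 // => j _; exact: sqr_ge0.
rewrite ord1 real_normK ?num_real // (bigD1 j) //= lerDl.
by apply: sumr_ge0 => k _; exact: sqr_ge0.
Qed.

(** [C] plays the part of the support: closed and inside O, it makes O and the complement of C an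
    open cover, on which a field multiplied by [rho] is smooth, respectively zero. *)
Lemma bump_function (x0 : M) (O : set M) : open O -> O x0 ->
  exists (rho : M -> R) (C : set M), [/\ rho x0 != 0, closed C, C `<=` O,
    forall x, ~ C x -> rho x = 0 &
    forall q, smooth_on (phi q @` cdom (phi q)) (rho \o cinv (phi q))].
Proof.
move=> oO Ox0; pose y0 := phi x0 x0; pose c := phi x0.
have cx0 : cdom c x0 := phi_dom x0.
have : nbhs y0 (c @` (cdom c `&` O)).
  by apply: open_nbhs_nbhs; split; [exact: open_chart_image|exists x0].
move/nbhs_ballP => [d /= d0 Hd].
pose e := d / 2; have e0 : 0 < e by rewrite divr_gt0.
pose K := closed_ball_ Num.norm y0 e.
have KU : K `<=` c @` (cdom c `&` O).
  move=> y Ky; apply: Hd; rewrite -ball_normE /= (le_lt_trans Ky) //.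
  by rewrite /e ltr_pdivrMr // ltr_pMr // ltr1n.
have cK : compact K.
  apply: bounded_closed_compact; last exact: closed_closed_ball_.
  exists (`|y0| + e); split; first exact: num_real.
  move=> z ze y Ky; apply: le_trans (ltW ze).
  rewrite -[y](subrK y0) addrC (le_trans (ler_normD _ _)) // lerD2l distrC.
  exact: Ky.
pose C := cinv c @` K.
(* C is closed in the chart domain, but closedness in all of M needs compactness and the Hausdorff
   property. *)
have clC : closed C.
  apply: compact_closed; first exact: manifold_hausdorff.
  apply: continuous_compact cK; apply: continuous_in_subspaceT => y.
  by rewrite inE => /KU[x [cx _] xy]; apply: cinv_cts; exists x.
have CO : C `<=` cdom c `&` O.
  by move=> _ [y /KU[x [cx Ox] <-] <-]; rewrite cmapK.
(* Outside the chart domain the value of [c] means nothing, hence the default 0; inside, [rho]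
   vanishes as soon as the squared distance reaches e^2. *)
pose rho x := if `[< cdom c x >] then flat 0 (e ^+ 2 - sqr_dist y0 (c x)) else 0.
have rho0 x : ~ C x -> rho x = 0.
  move=> nCx; rewrite /rho; case: asboolP => // cx; rewrite /flat ifF //.
  apply/negbTE; rewrite -leNgt subr_le0 (le_trans _ (sqr_dist_ge _ _)) //.
  rewrite lerXn2r ?nnegrE ?(ltW e0) // leNgt; apply/negP => lt_e; apply: nCx.
  by exists (c x); [rewrite /K /closed_ball_ /= distrC ltW|rewrite cmapK].
exists rho, C; split=> //.
- rewrite /rho asboolT // /sqr_dist subrr mul0mx mxE subr0 /flat exprn_gt0 //.
  by rewrite mulf_neq0 ?expr0 ?oner_neq0 // gt_eqF // expR_gt0.
- by move=> x /CO[].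
move=> q; apply: smooth_on_local => _ [x qx <-].
(* Either x lies in the domain of c, where the formula is smooth, or x is off C, near which [rho] is
   zero. *)
have [cx|ncx] := pselect (cdom c x).
  pose U := local_dom (@idfun M) setT q x0.
  have oU : open U by apply: open_local_dom; [move=> ?; exact: cvg_id|exact: openT].
  exists U; first by exists x.
  pose T := local_map (@idfun M) q x0.
  have sT : smooth_on U T := smooth_local_map _ _ _ (smooth_map_id M).
  apply: (@smooth_on_eq _ _ _ _ (fun y => flat 0 (e ^+ 2 - sqr_dist y0 (T y))) _ oU).
    move=> _ [z [[qz _] cz] <-]; rewrite /T (local_mapE (@idfun M) x0 qz) /= (cmapK qz).
    by rewrite /rho asboolT.
  apply: smooth_on_flat => //.
  have sD : smooth_on U (fun y => (T y - y0) *m (T y - y0)^T).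
    have sB : smooth_on U (fun y => T y - y0).
      exact: (smooth_onD oU sT (smooth_on_cst U (- y0))).
    exact: (smooth_on_mulmx oU sB (smooth_on_trmx oU sB)).
  have /(smooth_on_mxP oU)/(_ 0 0) := smooth_onN oU sD.
  move/(smooth_onD oU (smooth_on_cst U (e ^+ 2))).
  by apply: (smooth_on_eq oU) => y _; rewrite mxE.
pose U := phi q @` (cdom (phi q) `&` ~` C).
have oU : open U by apply: open_chart_image; exact: closed_openC.
exists U; first by exists x => //; split=> // /CO[].
apply: (@smooth_on_eq _ _ _ _ (cst 0) _ oU); last exact: smooth_on_cst.
by move=> _ [z [qz nCz] <-]; rewrite /= (cmapK qz) rho0.
Qed.

End BumpFunction.

Section Extension.
Variable R : realType.

Lemma smooth_along_cutoff m n (M : manifold R m) (P : manifold R n) (f : M -> P)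
    (O C : set M) (rho : M -> R) N :
  smooth_map f -> open O -> closed C -> C `<=` O -> (forall x, ~ C x -> rho x = 0) ->
  (forall q, smooth_on (phi q @` cdom (phi q)) (rho \o cinv (phi q))) ->
  smooth_along f O N -> smooth_along f setT (fun x => rho x *: N x).
Proof.
move=> sf oO cC CO rho0 srho sN q r; apply: smooth_on_local => _ [x [[qx _] rx] <-].
have [Ox|nOx] := pselect (O x).
  have oU : open (local_dom f O q r) by apply: open_local_dom => //; exact: sf.1.
  exists (local_dom f O q r); first by exists x.
  have QU : local_dom f O q r `<=` phi q @` cdom (phi q).
    by move=> _ [z [[qz _] _] <-]; exists z.
  apply: (smooth_on_eq oU _ (smooth_onZ oU (smooth_on_sub QU (srho q)) (sN q r))).
  by move=> y _; rewrite /= /coord_along scalemxAl.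
have oU : open (local_dom f (~` C) q r).
  by apply: open_local_dom; [exact: sf.1|exact: closed_openC].
exists (local_dom f (~` C) q r); first by exists x => //; do 2?split=> //; move/CO.
apply: (@smooth_on_eq _ _ _ _ (cst 0) _ oU); last exact: smooth_on_cst.
move=> _ [z [[qz nCz] rz] <-].
by rewrite /= (cmapK qz) /coord_along rho0 // scale0r mul0mx.
Qed.

(** The coordinates of u in the local frame at [x0] are kept constant, and the resulting field is
    cut off by [rho], normalized to 1 at [x0]. *)
Lemma distribution_section m (M : manifold R m) (E : M -> {vspace 'rV[R]_m}) x0 u :
  Defs.distribution E -> u \in E x0 -> exists2 X, sections E X & X x0 = u.
Proof.
move=> [k /(_ x0)[A [e [oA Ax0 se be]]]] uE.
have [rho [C [rho_x0 cC CO rho0 srho]]] := bump_function oA Ax0.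
pose b := [tuple e i x0 | i < k]; pose N x := \sum_i coord b i u *: e i x.
exists (fun x => (rho x / rho x0) *: N x); last first.
  rewrite divff // scale1r [RHS](coord_basis (be _ Ax0) uE).
  by apply: eq_bigr => i _; rewrite (nth_map i) ?size_enum_ord // nth_ord_enum.
split=> [|x]; last first.
  have [Ax|nAx] := pselect (A x); last first.
    by rewrite /= rho0 ?mul0r ?scale0r ?mem0v // => /CO.
  rewrite /= memvZ // memv_suml // => i _; rewrite memvZ //.
  by apply: (basis_mem (be _ Ax)); apply/mapP; exists i; rewrite ?mem_enum.
have sN : smooth_along (@idfun M) A N.
  move=> q r; have oU : open (local_dom (@idfun M) A q r).
    by apply: open_local_dom => // z; exact: cvg_id.
  have H i : smooth_on (local_dom (@idfun M) A q r)
      (fun y => coord b i u *: (coord_along (@idfun M) r (e i) \o cinv (phi q)) y).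
    by apply: smooth_onZ (se i q r) => //; exact: smooth_on_cst.
  apply: (smooth_on_eq oU _ (smooth_on_sum oU H)) => y _.
  rewrite /= /coord_along /N mulmx_suml; apply: eq_bigr => i _.
  by rewrite scalemxAl.
apply: (smooth_along_cutoff (rho := fun x => rho x / rho x0) (smooth_map_id M) oA cC CO _ _ sN).
  by move=> x /rho0 ->; rewrite mul0r.
move=> q; have oQ := @cimg_open _ _ _ (phi q).
exact: (smooth_onM oQ (srho q) (smooth_on_cst _ (rho x0)^-1)).
Qed.

End Extension.

(** * Quaternion CR-submanifolds *)

Section QuaternionCR.
Variables (R : realType) (n m : nat).
Variables (P : manifold R n) (g : P -> 'M[R]_n) (sigma : P -> {vspace 'M[R]_n}).
Variables (M : manifold R m) (f : M -> P) (D Dperp : M -> {vspace 'rV[R]_m}).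
Hypothesis hP : quaternion_kahler g sigma.
Hypothesis hM : quaternion_CR_submanifold g sigma f D Dperp.

Let h := induced_metric f g.

Let hg : riemannian g.
Proof. by case: hP. Qed.

Let sf : smooth_map f.
Proof. by case: hM => -[]. Qed.

Let rf x : row_free (dmap f x).
Proof. by case: hM => -[]. Qed.

Let hh : riemannian h := induced_riemannian sf hg rf.

Let oT : open [set: M] := openT.

Lemma ip_eq0 x u : ip h x u u = 0 -> u = 0.
Proof. by move=> u0; apply/eqP/negPn/negP => /(metric_pos hh x); rewrite u0 ltxx. Qed.

(** In u = d + d' the product of u with d is that of d with itself, so d = 0 by positivity. *)
Lemma mem_Dperp x u : (forall v, v \in D x -> ip h x u v = 0) -> u \in Dperp x.
Proof.
move=> uD; have : u \in (D x + Dperp x)%VS by rewrite (qcr_compl hM) memvf.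
case/memv_addP => d dD [d' d'D E]; suff -> : u = d' by [].
rewrite E (_ : d = 0) ?add0r //; apply: (@ip_eq0 x).
have := uD d dD; rewrite E ipDl (ipC _ d' d hh).
by rewrite (qcr_orth hM dD d'D) addr0.
Qed.

Lemma mem_D x u : (forall v, v \in Dperp x -> ip h x u v = 0) -> u \in D x.
Proof.
move=> uD; have : u \in (D x + Dperp x)%VS by rewrite (qcr_compl hM) memvf.
case/memv_addP => d dD [d' d'D E]; suff -> : u = d by [].
rewrite E (_ : d' = 0) ?addr0 //; apply: (@ip_eq0 x).
by have := uD d' d'D; rewrite E ipDl (qcr_orth hM dD d'D) add0r.
Qed.

Lemma mu_perp_J x U J a z : canonical_basis sigma U J -> U (f x) ->
  z \in Dperp x -> mu_perp sigma f Dperp x (z *m dmap f x *m J a (f x)).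
Proof.
move=> cJ Ox zD; exists U, J, (fun b => if b == a then z else 0); split=> //.
  by move=> b; case: ifP => // _; exact: mem0v.
rewrite (bigD1 a) //= eqxx big1 ?addr0 // => b /negPf ->.
by rewrite !mul0mx.
Qed.

Lemma ip_suml (I : finType) x (F : I -> 'rV[R]_n) w :
  ip g (f x) (\sum_i F i) w = \sum_i ip g (f x) (F i) w.
Proof.
apply: (big_morph (fun u => ip g (f x) u w)) => [u v|]; first exact: ipDl.
by rewrite /ip !mul0mx mxE.
Qed.

Lemma mu_perp_normal x w : mu_perp sigma f Dperp x w -> normal f g x w.
Proof.
case=> U [J [z [cJ Ox zD ->]]] u; rewrite ip_suml big1 // => a _.
exact: (qcr_real hM cJ Ox).
Qed.

Lemma mu_perp0 x : mu_perp sigma f Dperp x 0.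
Proof.
have [U [J [cJ Ox]]] := qk_basis hP (f x).
exists U, J, (fun=> 0); split=> // [a|]; first exact: mem0v.
by rewrite big1 // => a _; rewrite !mul0mx.
Qed.

Lemma mu_perpZ x c w : mu_perp sigma f Dperp x w -> mu_perp sigma f Dperp x (c *: w).
Proof.
case=> U [J [z [cJ Ox zD ->]]]; exists U, J, (fun a => c *: z a); split=> // [a|].
  exact: memvZ.
by rewrite scaler_sumr; apply: eq_bigr => a _; rewrite !scalemxAl.
Qed.

(* The pointwise form of the four conditions. *)
Definition sff_criterion := forall x w u v, mu_perp sigma f Dperp x w ->
  u \in Dperp x -> v \in D x -> ip g (f x) w (v *m sff f g x u) = 0.

(** J_a exists on U only, so J_a Z is cut off by a bump function supported in the preimage of U. *)
Lemma mu_perp_section x0 U J a z : canonical_basis sigma U J -> U (f x0) ->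
  z \in Dperp x0 ->
  exists2 N, sections_along f (mu_perp sigma f Dperp) N &
             N x0 = z *m dmap f x0 *m J a (f x0).
Proof.
move=> cJ Ox zD; have [Z [sZ ZD] Zx0] := distribution_section (qcr_Dperp hM) zD.
have oO : open U by case: cJ.
pose A := f @^-1` U; have oA : open A by move/continuousP: (sf.1); exact.
have [rho [C [rho_x0 cC CA rho0 srho]]] := bump_function oA (Ox : A x0).
pose N x := push f Z x *m J a (f x).
have sN : smooth_along f A N.
  have [_ sJ _ _ _] := cJ.
  have := smooth_along_end sf oT oO (sJ a) (smooth_push sf oT sZ).
  by apply: smooth_along_sub => x Ax; split.
exists (fun x => (rho x / rho x0) *: N x); last first.
  by rewrite divff // scale1r /N /push Zx0.
split=> [|x].
  apply: (smooth_along_cutoff (rho := fun x => rho x / rho x0) sf oA cC CA _ _ sN).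
    by move=> x /rho0 ->; rewrite mul0r.
  move=> q; have oQ := @cimg_open _ _ _ (phi q).
  exact: (smooth_onM oQ (srho q) (smooth_on_cst _ (rho x0)^-1)).
have [Ax|nAx] := pselect (A x); last first.
  by rewrite rho0 ?mul0r ?scale0r; [exact: mu_perp0|move/CA].
by apply: mu_perpZ; exact: (mu_perp_J a cJ Ax (ZD x)).
Qed.

(** The main computation, with w in the role of Y; the hypothesis relating them says that [w'] is
    J_a w. *)
Lemma nabla_Dperp x U J a X Z w w' : canonical_basis sigma U J -> U (f x) ->
  sections Dperp Z -> w' \in D x ->
  w *m dmap f x *m J a (f x) = w' *m dmap f x ->
  ip h x (nabla h X Z x) w =
  - ip g (f x) (push f Z x *m J a (f x)) (w' *m sff f g x (X x)).
Proof.
move=> cJ Ox [sZ ZD] w'D ww'; have [oO sJ bJ JJ _] := cJ.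
have oA : open (f @^-1` U) by move/continuousP: (sf.1); exact.
pose N y := push f Z y *m J a (f y).
have sN : smooth_along f (f @^-1` U) N.
  have := smooth_along_end sf oT oO (sJ a) (smooth_push sf oT sZ).
  by apply: smooth_along_sub => y Ay; split.
have nN y : (f @^-1` U) y -> normal f g y (N y).
  by move=> Oy; apply: (qcr_real hM cJ Oy); exact: ZD.
(* B is normal, so pairing with a tangent vector does not distinguish the two connections. *)
have E : ip h x (nabla h X Z x) w =
    ip g (f x) (cov_along f g X (push f Z) x) (w *m dmap f x).
  rewrite ip_induced; have := second_form_normal hg sf rf X sZ (I : setT x) w.
  rewrite /second_form ipDl ipNl => /eqP; rewrite subr_eq0 => /eqP <-.
  by [].
have ce : cov_end g (X x *m dmap f x) (J a) (f x) \in sigma (f x).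
  apply: (qk_parallel hP oO (sJ a) _ Ox) => p Op.
  by apply: (basis_mem (bJ p Op)); apply/mapP; exists a; rewrite ?mem_enum.
have Z0 b : ip g (f x) (push f Z x *m J b (f x)) (w' *m dmap f x) = 0.
  exact: (qcr_real hM cJ Ox b (ZD x)).
(* The covariant derivative of J_a is expanded in the basis of sigma, and [Z0] kills each term. *)
have K0 : ip g (f x) (push f Z x *m cov_end g (X x *m dmap f x) (J a) (f x))
    (w' *m dmap f x) = 0.
  move: (cov_end _ _ _ _) ce => A /(coord_basis (bJ _ Ox)) ->.
  rewrite mulmx_sumr ip_suml big1 // => b _.
  rewrite (nth_map b) ?size_enum_ord // nth_ord_enum -scalemxAr.
  by move: (Z0 b); rewrite /ip -!scalemxAl => Zb; rewrite mxE Zb mulr0.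
rewrite E -(qk_hermitian hP cJ Ox a) ww'.
have CE := cov_along_end g sf X oT oO (I : setT x) Ox (sJ a) (smooth_push sf oT sZ).
have := ipDl g (f x) (cov_along f g X (push f Z) x *m J a (f x))
  (push f Z x *m cov_end g (X x *m dmap f x) (J a) (f x)) (w' *m dmap f x).
rewrite K0 addr0 -CE => <-.
(* J_a Z is normal over the whole preimage of U, so the Weingarten equation applies to it. *)
rewrite -(shape_opE hg sf rf X w' oA Ox sN nN) /shape_op ipNl opprK.
by rewrite (ip_tangent_part hg sf rf).
Qed.

Lemma shape_op_ip N X x v : sections_along f (mu_perp sigma f Dperp) N ->
  ip h x (shape_op f g N X x) v = ip g (f x) (N x) (v *m sff f g x (X x)).
Proof.
move=> [sN nN]; apply: (shape_opE hg sf rf X v oT I sN) => y _.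
exact/mu_perp_normal/nN.
Qed.

Lemma smooth_shape_op N X : smooth_along (@idfun M) setT X -> smooth_along f setT N ->
  smooth_along (@idfun M) setT (shape_op f g N X).
Proof.
move=> sX sN; apply: (smooth_alongN (smooth_map_id M) oT).
exact: smooth_tangent_part sf hg rf oT (smooth_cov_along sf hg oT sX sN).
Qed.

Lemma smooth_nabla X Y : smooth_along (@idfun M) setT X ->
  smooth_along (@idfun M) setT Y -> smooth_along (@idfun M) setT (nabla h X Y).
Proof. by move=> sX sY; apply: (smooth_cov_along (smooth_map_id M) hh). Qed.

Lemma smooth_second_form X Y : smooth_along (@idfun M) setT X ->
  smooth_along (@idfun M) setT Y -> smooth_along f setT (second_form f g X Y).
Proof.
move=> sX sY; apply: (smooth_alongD sf oT).
  exact: (smooth_cov_along sf hg oT sX (smooth_push sf oT sY)).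
exact: (smooth_alongN sf oT (smooth_push sf oT (smooth_nabla sX sY))).
Qed.

Lemma sff_criterionP : (forall x U J a u v z, canonical_basis sigma U J -> U (f x) ->
    u \in Dperp x -> v \in D x -> z \in Dperp x ->
    ip g (f x) (z *m dmap f x *m J a (f x)) (v *m sff f g x u) = 0) ->
  sff_criterion.
Proof.
move=> H x w u v [U [J [z [cJ Ox zD ->]]]] uD vD.
by rewrite ip_suml big1 // => a _; exact: (H x U J a).
Qed.

Lemma geodesic_sff : foliation_totally_geodesic g f Dperp <-> sff_criterion.
Proof.
split=> [tg|cr].
  apply: sff_criterionP => x U J a u v z cJ Ox uD vD zD.
  have [X sX Xx] := distribution_section (qcr_Dperp hM) uD.
  have [Z sZ Zx] := distribution_section (qcr_Dperp hM) zD.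
  (* J_a^2 = -1, so v is the image under J_a of a vector of D. *)
  have [v' v'D vv'] := qcr_inv hM cJ Ox a vD.
  have [_ _ _ JJ _] := cJ.
  have E : - v' *m dmap f x *m J a (f x) = v *m dmap f x.
    by rewrite !mulNmx -vv' -(mulmxA (v *m dmap f x)) JJ // mulmxN mulmx1 opprK.
  have := nabla_Dperp X cJ Ox sZ vD E; rewrite /push Zx Xx => /esym/eqP.
  have nD : nabla h X Z x \in Dperp x by have [_ nD] := tg X Z sX sZ; exact: nD.
  rewrite (ipC _ _ _ hh) (qcr_orth hM _ nD) ?memvN // oppr_eq0.
  by move/eqP.
move=> X Z sX sZ; have [ssX XD] := sX; have [ssZ ZD] := sZ.
split=> [|x]; first exact: smooth_nabla.
(* In this direction a single J_a is enough to move w inside D; index 0 is taken. *)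
apply: mem_Dperp => w wD; have [U [J [cJ Ox]]] := qk_basis hP (f x).
have [w' w'D ww'] := qcr_inv hM cJ Ox 0 wD.
rewrite (nabla_Dperp X cJ Ox sZ w'D ww') cr ?oppr0 //; last exact: XD.
exact: (mu_perp_J 0 cJ Ox (ZD x)).
Qed.

Lemma second_form_mu_sff :
  (forall X Y, sections D X -> sections Dperp Y ->
    sections_along f (mu g sigma f Dperp) (second_form f g X Y)) <-> sff_criterion.
Proof.
split=> [H|cr].
  move=> x w u v wmu uD vD.
  have [X sX Xx] := distribution_section (qcr_D hM) vD.
  have [Y sY Yx] := distribution_section (qcr_Dperp hM) uD.
  have [_ /(_ x)[_ /(_ w wmu)]] := H X Y sX sY.
  rewrite (second_formE g sf X sY.1 (I : setT x)) Xx Yx (sff_sym hg sf rf).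
  by rewrite (ipC _ _ _ hg).
move=> X Y [sX XD] [sY YD]; split=> [|x]; first exact: smooth_second_form.
split; first exact: (second_form_normal hg sf rf X sY (I : setT x)).
move=> w wmu; rewrite (second_formE g sf X sY (I : setT x)) (sff_sym hg sf rf).
by rewrite (ipC _ _ _ hg) cr //; [exact: YD|exact: XD].
Qed.

Lemma shape_op_Dperp_sff :
  (forall X N, sections Dperp X -> sections_along f (mu_perp sigma f Dperp) N ->
    sections Dperp (shape_op f g N X)) <-> sff_criterion.
Proof.
split=> [H|cr].
  apply: sff_criterionP => x U J a u v z cJ Ox uD vD zD.
  have [X sX Xx] := distribution_section (qcr_Dperp hM) uD.
  have [N sN Nx] := mu_perp_section a cJ Ox zD.
  have [_ /(_ x) sD] := H X N sX sN.
  have := shape_op_ip X x v sN; rewrite Nx Xx => <-.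
  by rewrite (ipC _ _ _ hh) (qcr_orth hM vD sD).
move=> X N [sX XD] sN; have [ssN nN] := sN.
split=> [|x]; first exact: smooth_shape_op.
by apply: mem_Dperp => v vD; rewrite (shape_op_ip X x v sN) cr //; exact: XD.
Qed.

(** The symmetry of B turns A_N v paired with u into A_N u paired with v, so this reduces to the
    same criterion as the condition on [Dperp]. *)
Lemma shape_op_D_sff :
  (forall Y N, sections D Y -> sections_along f (mu_perp sigma f Dperp) N ->
    sections D (shape_op f g N Y)) <-> sff_criterion.
Proof.
split=> [H|cr].
  apply: sff_criterionP => x U J a u v z cJ Ox uD vD zD.
  have [Y sY Yx] := distribution_section (qcr_D hM) vD.
  have [N sN Nx] := mu_perp_section a cJ Ox zD.
  have [_ /(_ x) sD] := H Y N sY sN.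
  have := shape_op_ip Y x u sN; rewrite Nx Yx (sff_sym hg sf rf) => <-.
  by rewrite (qcr_orth hM sD uD).
move=> Y N [sY YD] sN; have [ssN nN] := sN.
split=> [|x]; first exact: smooth_shape_op.
apply: mem_D => v vD; rewrite (shape_op_ip Y x v sN) (sff_sym hg sf rf) cr //.
exact: YD.
Qed.

End QuaternionCR.

Theorem theorem3p1 (R : realType) (n m : nat)
    (Mbar : manifold R n) (gbar : Mbar -> 'M[R]_n)
    (sigma : Mbar -> {vspace 'M[R]_n})
    (M : manifold R m) (f : M -> Mbar) (D Dperp : M -> {vspace 'rV[R]_m})
    (hMbar : quaternion_kahler gbar sigma)
    (hM : quaternion_CR_submanifold gbar sigma f D Dperp) :
  [<-> (* (i) *)
       foliation_totally_geodesic gbar f Dperp;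
       (* (ii) *)
       forall X Y, sections D X -> sections Dperp Y ->
         sections_along f (mu gbar sigma f Dperp) (second_form f gbar X Y);
       (* (iii) *)
       forall X N, sections Dperp X ->
         sections_along f (mu_perp sigma f Dperp) N ->
         sections Dperp (shape_op f gbar N X);
       (* (iv) *)
       forall Y N, sections D Y ->
         sections_along f (mu_perp sigma f Dperp) N ->
         sections D (shape_op f gbar N Y)].
Proof.
have i := geodesic_sff hMbar hM; have ii := second_form_mu_sff hMbar hM.
have iii := shape_op_Dperp_sff hMbar hM; have iv := shape_op_D_sff hMbar hM.
tfae.
- by move/i/ii.
- by move/ii/iii.
- by move/iii/iv.
- by move/iv/i.
Qed.
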